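(* Let $A$ be a Nakayama algebra and let $\mathcal{E}$ be the set of isomorphism classes of simple $A$-modules. The map $h\colon\mathcal{E}\to\mathcal{E}$, $h(S)=\operatorname{top}\Omega^{e(S)}NS$, is a permutation of $\mathcal{E}$ with inverse $h^*\colon\mathcal{E}\to\mathcal{E}$, $h^*(S)=\operatorname{soc}\Sigma^{e^*(S)}N^*S$. If $S$ is a simple module, then $$e^*(h(S))=e(S).$$
   Context: A Nakayama algebra is an artin algebra such that all indecomposable modules are serial (i.e. have a unique composition series). Modules are left $A$-modules; $\operatorname{pd}$ and $\operatorname{id}$ denote projective and injective dimension (possibly $\infty$); $PS$ is a projective cover and $IS$ an injective envelope of $S$. $\Omega M$ is the kernel of a projective cover of $M$, and $\Sigma M$ is the cokernel of an injective envelope of $M$; $\Omega^z,\Sigma^z$ denote the iterates, with $\Omega^0M=M=\Sigma^0M$. For a simple module $S$ put $e(S)=\min\{\operatorname{pd} S,\operatorname{pd} IS\}$ and $e^*(S)=\min\{\operatorname{id} S,\operatorname{id} PS\}$ (these numbers are finite for a Nakayama algebra). Let $NS=S$ if $e(S)$ is odd and $NS=IS$ if $e(S)$ is even; let $N^*S=S$ if $e^*(S)$ is odd and $N^*S=PS$ if $e^*(S)$ is even. *)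

(* Defs.v *)
From mathcomp Require Import all_boot all_algebra all_classical.

Set Implicit Arguments.
Unset Strict Implicit.
Unset Printing Implicit Defensive.

Import GRing.Theory.

Local Open Scope classical_set_scope.
Local Open Scope ring_scope.

Section Modules.
Variable R : pzRingType.
Implicit Types M N P Q I S K C : lmodType R.

Definition submodule M (U : set M) : Prop := submod_closed (mem U).

Definition fin_gen M : Prop :=
  exists (n : nat) (g : 'I_n -> M),
    forall x : M, exists c : 'I_n -> R, x = \sum_(i < n) c i *: g i.

Definition simple_module M : Prop :=
  [set: M] <> [set 0] /\
  forall U : set M, submodule U -> U = [set 0] \/ U = setT.

Definition indecomposable M : Prop :=
  [set: M] <> [set 0] /\
  forall U V : set M, submodule U -> submodule V ->
    U `&` V = [set 0] -> (forall x, exists2 u, U u & V (x - u)) ->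
    U = [set 0] \/ V = [set 0].

(* V / U is a simple module, for submodules U and V. *)
Definition maximal_in M (U V : set M) : Prop :=
  U `<` V /\
  forall W : set M, submodule W -> U `<=` W -> W `<=` V -> W = U \/ W = V.

Fixpoint simple_chain M (U : set M) (s : seq (set M)) : Prop :=
  if s is V :: s' then [/\ submodule V, maximal_in U V & simple_chain V s']
  else U = setT.

(* The seq s lists the nonzero terms M_1, ..., M_n = M of the series. *)
Definition composition_series M (s : seq (set M)) : Prop :=
  simple_chain [set 0] s.

Definition serial M : Prop := exists! s, @composition_series M s.

Definition isomorphic M N : Prop := exists f : {linear M -> N}, bijective f.

Definition short_exact K M N (i : {linear K -> M}) (p : {linear M -> N}) :
    Prop :=
  [/\ injective i, range i = p @^-1` [set 0] & range p = setT].

Definition projective P : Prop :=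
  forall M N (g : {linear M -> N}) (f : {linear P -> N}),
    range g = setT -> exists f' : {linear P -> M}, g \o f' =1 f.

Definition injective_module I : Prop :=
  forall M N (g : {linear M -> N}) (f : {linear M -> I}),
    injective g -> exists f' : {linear N -> I}, f' \o g =1 f.

Definition superfluous M (K : set M) : Prop :=
  forall U : set M, submodule U ->
    (forall x, exists2 u, U u & K (x - u)) -> U = setT.

Definition essential M (K : set M) : Prop :=
  forall U : set M, submodule U -> K `&` U = [set 0] -> U = [set 0].

Definition projective_cover P M (p : {linear P -> M}) : Prop :=
  [/\ projective P, range p = setT & superfluous (p @^-1` [set 0])].

Definition injective_envelope M I (i : {linear M -> I}) : Prop :=
  [/\ injective_module I, injective i & essential (range i)].

Definition is_proj_cover M P : Prop :=
  exists p : {linear P -> M}, projective_cover p.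

Definition is_inj_envelope M I : Prop :=
  exists i : {linear M -> I}, injective_envelope i.

Definition is_syzygy M K : Prop :=
  exists P (p : {linear P -> M}) (i : {linear K -> P}),
    projective_cover p /\ short_exact i p.

Definition is_cosyzygy M C : Prop :=
  exists I (i : {linear M -> I}) (p : {linear I -> C}),
    injective_envelope i /\ short_exact i p.

(* Equals setT when M has no maximal submodule. *)
Definition radical M : set M :=
  \bigcap_(U in [set U : set M | submodule U /\ maximal_in U setT]) U.

(* The sum of the simple submodules of M is the least submodule containing
   all of them. *)
Definition socle M : set M :=
  \bigcap_(U in [set U : set M | submodule U /\
    forall V : set M, submodule V -> maximal_in [set 0] V -> V `<=` U]) U.

Definition is_top M N : Prop :=
  exists p : {linear M -> N},
    range p = setT /\ p @^-1` [set 0] = @radical M.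

Definition is_soc M N : Prop :=
  exists i : {linear N -> M}, injective i /\ range i = @socle M.

(* These modules are determined only up to isomorphism: a representative is
   chosen, with junk value M when there is none. *)
Definition choose_module (X : lmodType R -> Prop) M : lmodType R :=
  if pselect (exists N, X N) is left XN then projT1 (cid XN) else M.

Definition PC M := choose_module (is_proj_cover M) M.
Definition IE M := choose_module (is_inj_envelope M) M.
Definition Omega M := choose_module (is_syzygy M) M.
Definition Sigma M := choose_module (is_cosyzygy M) M.
Definition top M := choose_module (is_top M) M.
Definition soc M := choose_module (is_soc M) M.

(* M has a projective resolution 0 -> P_n -> ... -> P_0 -> M -> 0. *)
Fixpoint pd_le (n : nat) M : Prop :=
  if n is n'.+1 then
    exists P K (i : {linear K -> P}) (p : {linear P -> M}),
      [/\ projective P, short_exact i p & pd_le n' K]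
  else projective M.

Fixpoint id_le (n : nat) M : Prop :=
  if n is n'.+1 then
    exists I C (i : {linear M -> I}) (p : {linear I -> C}),
      [/\ injective_module I, short_exact i p & id_le n' C]
  else injective_module M.

(* Elements of nat together with infinity, the latter being None. *)
Definition least (X : nat -> Prop) : option nat :=
  if pselect (exists n, `[< X n >]) is left Xn then Some (ex_minn Xn)
  else None.

Definition min_inf (x y : option nat) : option nat :=
  match x, y with
  | Some m, Some n => Some (minn m n)
  | Some m, None => Some m
  | None, _ => y
  end.

Definition pdim M : option nat := least (pd_le ^~ M).
Definition idim M : option nat := least (id_le ^~ M).

Definition e S : option nat := min_inf (pdim S) (pdim (IE S)).
Definition e_star S : option nat := min_inf (idim S) (idim (PC S)).

(* The value S is junk when e S, respectively e_star S, is infinite. *)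
Definition NN S : lmodType R :=
  if e S is Some n then (if odd n then S else IE S) else S.
Definition NN_star S : lmodType R :=
  if e_star S is Some n then (if odd n then S else PC S) else S.

Definition iso_class M : lmodType R -> Prop := isomorphic M.

Definition simple_class : Type :=
  {C : lmodType R -> Prop | exists2 S, simple_module S & C = iso_class S}.

Definition class_of S (sS : simple_module S) : simple_class :=
  exist _ (iso_class S) (ex_intro2 _ _ S sS erefl).

End Modules.

Definition artinian (k : comPzRingType) : Prop :=
  forall J : nat -> set k^o,
    (forall n, submodule (J n)) -> (forall n, J n.+1 `<=` J n) ->
    exists m, forall n, (m <= n)%N -> J n = J m.

Definition artin_algebra (A : pzRingType) : Prop :=
  exists (k : comPzRingType) (phi : {rmorphism k -> A}),
    [/\ artinian k,
        forall c a, phi c * a = a * phi c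
      & exists (n : nat) (g : 'I_n -> A),
          forall a, exists c : 'I_n -> k, a = \sum_(i < n) phi (c i) * g i].

(* Only finitely generated modules are required to be serial, as is usual for
   artin algebras; this is the weaker form of the condition. *)
Definition nakayama_algebra (A : pzRingType) : Prop :=
  artin_algebra A /\
  forall M : lmodType A, fin_gen M -> indecomposable M -> serial M.

(* Main.v *)
From HB Require Import structures.
From mathcomp Require Import all_boot all_algebra all_classical.
From mathcomp Require Import zify.
Require Import Defs.

Set Implicit Arguments.
Unset Strict Implicit.
Unset Printing Implicit Defensive.

Import GRing.Theory.

Local Open Scope classical_set_scope.
Local Open Scope ring_scope.

(** Over a Nakayama algebra the finitely generated indecomposable modules are
uniserial, so such a module is determined up to isomorphism by its top and its
length. This turns the theorem into a statement about a monotone function on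
the natural numbers and its adjoint.

Fix a simple module S. Let P 0 be the projective cover of IS, let P (i + 1) be
the projective cover of the radical of P i, and let l i be the length of P i. A
quotient of P i of length j - i is written [i, j[ (predicate [seg]): its
composition factors from top to socle are the tops of P i, ..., P (j - 1). The
function p i = i + l i is monotone because the radical of P i is a quotient of
P (i + 1). The kernel of the projection from P i = [i, p i[ to [i, j[ is
[j, p i[, so
      Omega [i, j[ = [j, p i[.
Let q be the lower adjoint of p: q j <= i if and only if j <= p i. Then [q j, j[
is the longest interval ending in j, and a longest uniserial module with given
socle is injective, so
      Sigma [i, j[ = [q j, i[.
If IS has length b = a + 1, then IS = [0, b[ and S = [a, b[; the formula for
Sigma holds for b <= j, and only such intervals are met below ([seg_hull]).

The minimal projective resolution of [i, j[ is therefore read off the sequence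
i, j, p i, p j, p (p i), ... and stops at its first repetition; the minimal
injective resolution is read off j, i, q j, q i, ... in the same way. Applied to
S and to IS, this shows that e(S) is the least n such that
      p^k b = p^(k+1) 0        if n = 2k,
      p^(k+1) a = p^(k+1) b    if n = 2k + 1.
Such an n exists ([stop_exists]): either some P i vanishes, and the iterates of
p reach a fixed point, or the P i are periodic up to isomorphism, and a
counting argument modulo the period applies. For n = e(S) the module
Omega^n(NS) is projective, say [c, p c[, so h(S) = T with T = [c, c + 1[ and
PT = [c, p c[. The strict inequalities that hold before step n are turned around
by the adjunction: they say that the dual sequences of T and PT decrease
strictly up to step n, and that the sequence of N*T ends there with the interval
[0, b[. So e*(T) = n and Sigma^n(N*T) is isomorphic to IS, with socle S
([matching]).

In particular T determines S, so h is injective. There are finitely many simple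
modules, so h is bijective, and its inverse is h*.

The intervals rest on the following facts. The regular module is a sum of
finitely many uniserial projective modules ([reg_reached]), which gives
projective covers; injective envelopes are found among the uniserial modules of
maximal length ([hull_exists]). Two projective modules whose radicals have the
same nonzero projective cover are isomorphic ([cover_of_radical_inj]): this is
what makes [q j, j[ the only candidate for an injective envelope. Arbitrary
resolutions are compared with minimal ones through direct summands
([uret_syzygy], [uret_cosyzygy]). *)

(** * Submodules, quotients and factorization of linear maps *)

Section Submodules.
Variable R : pzRingType.
Implicit Types M N K Q X Y : lmodType R.

Lemma submoduleP M (U : set M) :
  submodule U <-> U 0 /\ forall a x y, U x -> U y -> U (a *: x + y).
Proof.
have memE x : (x \in mem U) = `[< U x >] by [].
rewrite /submodule; split=> -[U0 Ul]; split.
- by move: U0; rewrite memE => /asboolP.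
- move=> a x y Ux Uy; apply/asboolP; rewrite -memE.
  by apply: Ul; rewrite memE; apply/asboolP.
- by rewrite memE; apply/asboolP.
- move=> a x y; rewrite !memE => /asboolP Ux /asboolP Uy.
  exact/asboolP/Ul.
Qed.

Section Closure.
Variables (M : lmodType R) (U : set M) (sU : submodule U).
Lemma sub0 : U 0. Proof. by case/submoduleP: sU. Qed.
Lemma subL a x y : U x -> U y -> U (a *: x + y).
Proof. by case/submoduleP: sU => _; exact. Qed.
Lemma subD x y : U x -> U y -> U (x + y).
Proof. by move=> Ux Uy; rewrite -[x]scale1r; exact: subL. Qed.
Lemma subZ a x : U x -> U (a *: x).
Proof. by move=> Ux; rewrite -[_ *: _]addr0; apply: subL => //; exact: sub0. Qed.
Lemma subN x : U x -> U (- x).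
Proof. by move=> Ux; rewrite -scaleN1r; exact: subZ. Qed.
Lemma subB x y : U x -> U y -> U (x - y).
Proof. by move=> Ux /subN; exact: subD. Qed.
Lemma subDr x y : U y -> U (x + y) -> U x.
Proof. by move=> Uy /subB /(_ Uy); rewrite addrK. Qed.
Lemma subBr x y : U y -> U (x - y) -> U x.
Proof. by move=> Uy /subD /(_ Uy); rewrite subrK. Qed.
End Closure.

Lemma submodule0 M : submodule [set (0 : M)].
Proof.
by apply/submoduleP; split=> // a x y /= -> ->; rewrite scaler0 addr0.
Qed.

Lemma submoduleT M : submodule [set: M].
Proof. exact/submoduleP. Qed.

Lemma sub_eq0 M (U : set M) : submodule U -> U `<=` [set 0] -> U = [set 0].
Proof. by move=> sU U0; apply/seteqP; split=> // x ->; exact: sub0. Qed.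

Lemma submoduleI M (U V : set M) : submodule U -> submodule V ->
  submodule (U `&` V).
Proof.
move=> sU sV; apply/submoduleP; split; first by split; exact: sub0.
by move=> a x y [? ?] [? ?]; split; exact: subL.
Qed.

Lemma submodule_bigcap M (F : set (set M)) : (forall U, F U -> submodule U) ->
  submodule (\bigcap_(U in F) U).
Proof.
move=> sF; apply/submoduleP; split=> [U /sF/sub0//|a x y Fx Fy U FU].
by apply: subL; [exact: sF | exact: Fx | exact: Fy].
Qed.

Definition sums M (U V : set M) : set M :=
  [set x | exists2 u, U u & V (x - u)].

Lemma submodule_sums M (U V : set M) : submodule U -> submodule V ->
  submodule (sums U V).
Proof.
move=> sU sV; apply/submoduleP; split.
  by exists 0; rewrite ?subrr; exact: sub0.
move=> a x y [u Uu Vu] [w Uw Vw]; exists (a *: u + w); first exact: subL.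
by rewrite opprD addrACA -scalerBr; exact: subL.
Qed.

Lemma sumsl M (U V : set M) : submodule V -> U `<=` sums U V.
Proof. by move=> sV x Ux; exists x; rewrite ?subrr//; exact: sub0. Qed.

Lemma sumsr M (U V : set M) : submodule U -> V `<=` sums U V.
Proof. by move=> sU x Ux; exists 0; rewrite ?subr0//; exact: sub0. Qed.

Definition cyc M (x : M) : set M := range (fun a : R => a *: x).

Lemma submodule_cyc M (x : M) : submodule (cyc x).
Proof.
apply/submoduleP; split; first by exists 0; rewrite ?scale0r.
move=> a _ _ [b _ <-] [c _ <-]; exists (a * b + c) => //.
by rewrite scalerA scalerDl.
Qed.

Lemma cyc_id M (x : M) : cyc x x.
Proof. by exists 1; rewrite ?scale1r. Qed.

Section Linear.
Variables (M N : lmodType R) (f : {linear M -> N}).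

Lemma submodule_image (U : set M) : submodule U -> submodule (f @` U).
Proof.
move=> sU; apply/submoduleP; split.
  by exists 0; [exact: sub0 | exact: linear0].
move=> a _ _ [x Ux <-] [y Uy <-]; exists (a *: x + y); first exact: subL.
by rewrite linearP.
Qed.

Lemma submodule_range : submodule (range f).
Proof. exact/submodule_image/submoduleT. Qed.

Lemma submodule_preimage (V : set N) : submodule V -> submodule (f @^-1` V).
Proof.
move=> sV; apply/submoduleP; split; first by rewrite /= linear0; exact: sub0.
by move=> a x y /= Vx Vy; rewrite linearP; exact: subL.
Qed.

Lemma submodule_ker : submodule (f @^-1` [set 0]).
Proof. exact/submodule_preimage/submodule0. Qed.

Lemma inj_ker : injective f <-> f @^-1` [set 0] = [set 0].
Proof.
split=> [fi|k0 x y fxy].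
  apply: sub_eq0; first exact: submodule_ker.
  by move=> x /= fx; apply: fi; rewrite fx linear0.
have : (f @^-1` [set 0]) (x - y) by rewrite /= linearB fxy subrr.
by rewrite k0 => /eqP; rewrite subr_eq0 => /eqP.
Qed.

Lemma inj_ker0 : (forall x, f x = 0 -> x = 0) -> injective f.
Proof.
move=> f0; apply/inj_ker; apply: sub_eq0; first exact: submodule_ker.
exact: f0.
Qed.

Lemma rangeTP : range f = setT <-> forall y, exists x, f x = y.
Proof.
split=> [fT y|fs]; last by apply/seteqP; split=> // y _; have [x <-] := fs y; exists x.
by have : [set: N] y by []; rewrite -fT => -[x _ <-]; exists x.
Qed.
End Linear.

Lemma linear_of M N (f : M -> N) : linear f -> exists g : {linear M -> N}, g =1 f.
Proof.
move=> lf.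
pose m := GRing.isLinear.Build R M N *:%R f lf.
pose g : {linear M -> N} := HB.pack f m.
by exists g.
Qed.

(** A single construction serves for submodules and for quotients: the
subquotient V / U is carried by chosen representatives of the cosets of U in V;
s forgets and t projects. *)
Lemma subquo_exists M (V U : set M) : submodule V -> submodule U -> U `<=` V ->
  exists (Q : lmodType R) (s : Q -> M) (t : M -> Q),
  [/\ cancel s t, forall q, V (s q), forall x, V x -> U (x - s (t x)),
      forall x, V x -> (t x = 0 <-> U x)
    & forall a x y, V x -> V y -> t (a *: x + y) = a *: t x + t y].
Proof.
move=> sV sU UV.
pose cs (x : M) : set M := [set y | U (x - y)].
have csE x y : U (x - y) -> cs x = cs y.
  move=> Uxy; apply/seteqP; split=> z /= Uz.
    by have := subB sU Uz Uxy; rewrite opprB addrC addrA subrK.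
  by have := subD sU Uxy Uz; rewrite addrA subrK.
pose rho x : M := xget 0 (cs x).
have rhoP x : U (x - rho x).
  have : cs x x by rewrite /cs /= subrr; exact: sub0.
  by move/(xgetI 0).
have rhoE x y : U (x - y) -> rho x = rho y by rewrite /rho => /csE ->.
have rhoV x : V x -> V (rho x).
  by move=> Vx; have := subB sV Vx (UV _ (rhoP x)); rewrite opprB addrC subrK.
have rhoK x : rho (rho x) = rho x by apply/esym/rhoE.
pose T := {x : M | `[< V x /\ rho x = x >]}.
pose s (q : T) : M := val q.
have Vs q : V (s q) by have /asboolP[] := valP q.
have rs q : rho (s q) = s q by have /asboolP[] := valP q.
have tP x : exists q : T, V x -> s q = rho x.
  have [Vx|nVx] := pselect (V x).
    have Px : `[< V (rho x) /\ rho (rho x) = rho x >].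
      by apply/asboolP; split; [exact: rhoV|exact: rhoK].
    by exists (Sub (rho x) Px) => _.
  have P0 : `[< V (rho 0) /\ rho (rho 0) = rho 0 >].
    by apply/asboolP; split; [exact: rhoV (sub0 sV)|exact: rhoK].
  by exists (Sub (rho 0) P0) => Vx; case: nVx.
pose t x : T := projT1 (cid (tP x)).
have st x : V x -> s (t x) = rho x by rewrite /t; case: cid.
have sI : injective s by exact: val_inj.
have ts : cancel s t by move=> q; apply: sI; rewrite st.
have tE x y : V x -> V y -> U (x - y) -> t x = t y.
  by move=> Vx Vy Uxy; apply: sI; rewrite !st//; exact: rhoE.
have Ut x : V x -> U (x - s (t x)) by move=> Vx; rewrite st.
have Ut' x : V x -> U (s (t x) - x).
  by move=> Vx; rewrite -opprB; apply: (subN sU); exact: Ut.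
have sVD := subD sV; have sVZ := subZ sV; have sVN := subN sV.
have sV0 := sub0 sV.
pose add (p q : T) := t (s p + s q).
pose opp (p : T) := t (- s p).
pose scl (a : R) (p : T) := t (a *: s p).
have tD x y : V x -> V y -> add (t x) (t y) = t (x + y).
  move=> Vx Vy; apply: tE; try by auto.
  by rewrite opprD addrACA; apply: (subD sU); exact: Ut'.
have tZ a x : V x -> scl a (t x) = t (a *: x).
  move=> Vx; apply: tE; try by auto.
  by rewrite -scalerBr; apply: (subZ sU); exact: Ut'.
have tN x : V x -> opp (t x) = t (- x).
  move=> Vx; apply: tE; try by auto.
  by rewrite -opprD; apply: (subN sU); exact: Ut'.
have rep q : exists2 x, V x & q = t x by exists (s q).
have addA : associative add.
  move=> p q r; have [[x Vx ->] [y Vy ->]] := (rep p, rep q); have [z Vz ->] := rep r.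
  by rewrite !tD ?addrA; auto.
have addC : commutative add by move=> p q; rewrite /add addrC.
have add0 : left_id (t 0) add.
  by move=> p; have [x Vx ->] := rep p; rewrite tD// add0r.
have addN : left_inverse (t 0) opp add.
  by move=> p; have [x Vx ->] := rep p; rewrite tN// tD ?addNr; auto.
pose zm := GRing.isZmodule.Build T addA addC add0 addN.
pose Z : zmodType := HB.pack T zm.
have sclA a b (v : Z) : scl a (scl b v) = scl (a * b) v.
  by have [x Vx ->] := rep v; rewrite !tZ ?scalerA; auto.
have scl1 : left_id 1 scl by move=> v; have [x Vx ->] := rep v; rewrite tZ// scale1r.
have sclDr : right_distributive scl (+%R : Z -> Z -> Z).
  move=> a u v; have [[x Vx ->] [y Vy ->]] := (rep u, rep v).
  by rewrite [_ + _]tD// !tZ ?[RHS]tD ?scalerDr; auto.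
have sclDl (v : Z) : {morph (fun a : R => scl a v : Z) : a b / a + b}.
  move=> a b /=; have [x Vx ->] := rep v.
  by rewrite !tZ// [RHS]tD ?scalerDl; auto.
pose lm := GRing.Zmodule_isLmodule.Build R Z sclA scl1 sclDr sclDl.
pose Q : lmodType R := HB.pack T zm lm.
exists Q, s, t; split=> //.
- move=> x Vx; split=> [t0|Ux].
    have U0 : U (s (t 0)) by have := Ut' 0 sV0; rewrite subr0.
    by have := Ut x Vx; rewrite t0; exact: (subBr sU U0).
  by apply: tE => //; rewrite subr0.
- by move=> a x y Vx Vy; rewrite -[RHS]/(add (scl a (t x)) (t y)) tZ// tD; auto.
Qed.

Lemma sub_exists M (U : set M) : submodule U ->
  exists (K : lmodType R) (i : {linear K -> M}), injective i /\ range i = U.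
Proof.
move=> sU; have [|K [s [t [st Us sT t0 tl]]]] := subquo_exists sU (@submodule0 M).
  by move=> x ->; exact: sub0.
have ts x : U x -> s (t x) = x by move=> /sT /subr0_eq.
have sl : linear s.
  move=> a p q; rewrite -(ts (a *: s p + s q)); last exact: subL.
  by rewrite tl// !st.
have [i iE] := linear_of sl; exists K, i; split.
  by move=> x y; rewrite !iE; exact: (can_inj st).
apply/seteqP; split=> [_ [x _ <-]|x Ux]; first by rewrite iE.
by exists (t x) => //; rewrite iE ts.
Qed.

Lemma quo_exists M (U : set M) : submodule U ->
  exists (Q : lmodType R) (p : {linear M -> Q}),
    range p = setT /\ p @^-1` [set 0] = U.
Proof.
move=> sU; have [//|Q [s [t [st _ _ t0 tl]]]] := subquo_exists (@submoduleT M) sU.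
have [|p pE] := @linear_of _ _ t; first by move=> a x y; exact: tl.
exists Q, p; split.
  by apply/seteqP; split=> // q _; exists (s q); rewrite // pE st.
by apply/seteqP; split=> x /=; rewrite pE => /t0 => //; apply.
Qed.

Lemma lift_inj M N K (i : {linear K -> N}) (f : {linear M -> N}) :
  injective i -> range f `<=` range i ->
  exists g : {linear M -> K}, forall x, i (g x) = f x.
Proof.
move=> ii fi.
have gP x : exists y, i y = f x by have [|y _] := fi (f x); [exists x | exists y].
pose g x := projT1 (cid (gP x)).
have gE x : i (g x) = f x by rewrite /g; case: cid.
have [|g' g'E] := @linear_of _ _ g.
  by move=> a x y; apply: ii; rewrite gE !linearP !gE.
by exists g' => x; rewrite g'E.
Qed.

Lemma fact_surj M N Q (p : {linear M -> Q}) (f : {linear M -> N}) :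
  range p = setT -> (forall x, p x = 0 -> f x = 0) ->
  exists g : {linear Q -> N}, forall x, g (p x) = f x.
Proof.
move=> /rangeTP pT pf.
pose s q := projT1 (cid (pT q)).
have sE q : p (s q) = q by rewrite /s; case: cid.
have fE x y : p x = p y -> f x = f y.
  by move=> pxy; apply/eqP; rewrite -subr_eq0 -linearB pf// linearB pxy subrr.
have [|g gE] := @linear_of _ _ (f \o s).
  by move=> a x y /=; rewrite -linearP; apply: fE; rewrite linearP !sE.
by exists g => x; rewrite gE /=; apply: fE; rewrite sE.
Qed.

Lemma bij_inv M N (f : {linear M -> N}) : injective f -> range f = setT ->
  exists g : {linear N -> M}, cancel f g /\ cancel g f.
Proof.
move=> fi fT; have [|g gE] := @lift_inj N N M f idfun fi; first by rewrite fT.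
by exists g; split=> // x; apply: fi; rewrite gE.
Qed.

Lemma isoP M N :
  isomorphic M N <-> exists f : {linear M -> N}, injective f /\ range f = setT.
Proof.
split=> -[f].
  move=> fb; exists f; split; first exact: bij_inj.
  by case: fb => g fK gK; apply/rangeTP => y; exists (g y).
by case=> fi /(bij_inv fi)[g [fK gK]]; exists f; exists g.
Qed.

Lemma isoI M N (f : {linear M -> N}) : injective f -> range f = setT ->
  isomorphic M N.
Proof. by move=> fi fT; apply/isoP; exists f. Qed.

Lemma iso_refl M : isomorphic M M.
Proof. by exists idfun; exists id. Qed.

Lemma iso_sym M N : isomorphic M N -> isomorphic N M.
Proof. by case/isoP=> f [fi /(bij_inv fi)[g [fK gK]]]; exists g; exists f. Qed.

Lemma iso_trans N M K : isomorphic M N -> isomorphic N K -> isomorphic M K.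
Proof. by case=> f fb [g gb]; exists (g \o f); exact: bij_comp. Qed.

Lemma iso_classE M N : isomorphic M N -> iso_class M = iso_class N.
Proof.
move=> MN; apply/funext => K; apply/propext; split=> H.
  exact: iso_trans (iso_sym MN) H.
exact: iso_trans MN H.
Qed.

Lemma quo_iso M X Y (f : {linear M -> X}) (g : {linear M -> Y}) :
  range f = setT -> range g = setT -> f @^-1` [set 0] = g @^-1` [set 0] ->
  isomorphic X Y.
Proof.
move=> fT gT fg; have [|h hE] := @fact_surj _ Y _ f g fT.
  by move=> x fx; have : (f @^-1` [set 0]) x by []; rewrite fg.
apply: (@isoI _ _ h).
  apply: inj_ker0 => y; have /rangeTP/(_ y)[x <-] := fT; rewrite hE => gx.
  by have : (g @^-1` [set 0]) x by []; rewrite -fg.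
by apply/rangeTP => y; have /rangeTP/(_ y)[x <-] := gT; exists (f x).
Qed.

Lemma sub_iso M X Y (f : {linear X -> M}) (g : {linear Y -> M}) :
  injective f -> injective g -> range f = range g -> isomorphic X Y.
Proof.
move=> fi gi fg; have [|h hE] := @lift_inj X M Y g f gi; first by rewrite fg.
apply: (@isoI _ _ h).
  by move=> x y hxy; apply: fi; rewrite -!hE hxy.
apply/rangeTP => y; have : range g (g y) by exists y.
by rewrite -fg => -[x _ fx]; exists x; apply: gi; rewrite hE.
Qed.

(** Turns an internal direct sum into a linear map, from which retractions are
obtained by factoring. *)
Lemma proj_exists M (U V : set M) : submodule U -> submodule V ->
  U `&` V `<=` [set 0] -> sums U V = setT ->
  exists p : {linear M -> M},
    [/\ forall x, U x -> p x = x, range p = U & p @^-1` [set 0] = V].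
Proof.
move=> sU sV UV UVT.
have pP x : exists u, U u /\ V (x - u).
  by have : [set: M] x by []; rewrite -UVT => -[u]; exists u.
pose p x := projT1 (cid (pP x)).
have Up x : U (p x) by rewrite /p; case: cid => ? [].
have Vp x : V (x - p x) by rewrite /p; case: cid => ? [].
have pE x u : U u -> V (x - u) -> p x = u.
  move=> Uu Vu; apply/eqP; rewrite -subr_eq0; apply/eqP/UV.
  split; first exact: subB.
  by have := subB sV Vu (Vp x); rewrite opprB addrC addrA subrK.
have [|q qE] := @linear_of _ _ p.
  move=> a x y; apply: pE; first exact: subL.
  by rewrite opprD addrACA -scalerBr; exact: subL.
exists q; split=> [x Ux||].
- by rewrite qE; apply: pE => //; rewrite subrr; exact: sub0.
- apply/seteqP; split=> [_ [x _ <-]|x Ux]; first by rewrite qE.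
  by exists x => //; rewrite qE; apply: pE => //; rewrite subrr; exact: sub0.
- apply/seteqP; split=> [x /= px|x Vx /=].
    by move: px (Vp x); rewrite qE => ->; rewrite subr0.
  by rewrite qE; apply: pE; [exact: (sub0 sU) | rewrite subr0].
Qed.

End Submodules.

(** * Uniserial modules of finite length *)
Section Uniserial.
Variable R : pzRingType.
Implicit Types M N K Q S T : lmodType R.

(** The submodule of length k of a uniserial module, defined without reference
to uniseriality: each term is the least submodule strictly above the previous
one. Past the whole module the intersection is empty, so the filtration stays at
the whole module. *)
Fixpoint filt M (k : nat) : set M :=
  if k is k'.+1 then \bigcap_(U in [set U | submodule U /\ @filt M k' `<` U]) U
  else [set 0].
Arguments filt : clear implicits.

Definition uniserial M n := [/\ filt M n = setT, forall k, (k < n)%N -> filt M k `<` filt M k.+1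
  & forall U, submodule U -> exists2 k, (k <= n)%N & U = filt M k].

Lemma submodule_filt M k : submodule (filt M k).
Proof.
case: k => [|k]; first exact: submodule0.
by apply: submodule_bigcap => U [].
Qed.

Lemma filt_mono M i j : (i <= j)%N -> filt M i `<=` filt M j.
Proof.
move=> /subnK <-; elim: (j - i)%N => // k IH; rewrite addSn.
by apply: subset_trans IH _ => x fx U [_ [] + _]; exact.
Qed.

Section Theory.
Variables (M : lmodType R) (n : nat) (uM : uniserial M n).
Implicit Types U V : set M.

Lemma filtT : filt M n = setT. Proof. by case: uM. Qed.

Lemma filtE U : submodule U -> exists2 k, (k <= n)%N & U = filt M k.
Proof. by case: uM => _ _ /(_ U). Qed.

Lemma filt_lt i j : (i < j)%N -> (j <= n)%N -> filt M i `<` filt M j.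
Proof.
move=> ij jn; case: uM => _ /(_ i) ltS _; have [|_ ns] := ltS; first by lia.
by split=> [|ji]; [apply: filt_mono; lia | apply: ns; apply: subset_trans ji; exact: filt_mono].
Qed.

Lemma filt_le i j : (i <= n)%N -> filt M i `<=` filt M j -> (i <= j)%N.
Proof. by move=> iN ij; rewrite leqNgt; apply/negP => /filt_lt/(_ iN)[_]. Qed.

Lemma filt_inj i j : (i <= n)%N -> (j <= n)%N -> filt M i = filt M j -> i = j.
Proof. by move=> iN jn ij; apply/anti_leq/andP; split; apply: filt_le; rewrite ?ij. Qed.

Lemma uni_total U V : submodule U -> submodule V -> U `<=` V \/ V `<=` U.
Proof.
move=> /filtE[i _ ->] /filtE[j _ ->].
by have [ij|/ltnW ij] := leqP i j; [left|right]; exact: filt_mono.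
Qed.

Lemma uni_proper U : submodule U -> U <> setT -> U `<=` filt M n.-1.
Proof.
move=> /filtE[i iN ->]; rewrite -filtT => ne; apply: filt_mono.
by move: iN; rewrite leq_eqVlt => /predU1P[in_|]; [case: ne; rewrite in_|lia].
Qed.

Lemma uni_nz U : submodule U -> U <> [set 0] -> filt M 1 `<=` U.
Proof. by move=> /filtE[[|i] iN ->] // _; exact: filt_mono. Qed.

Lemma uni0 : n = 0%N -> forall x : M, x = 0.
Proof. by move=> n0 x; have : [set: M] x by []; rewrite -filtT n0. Qed.

Lemma uni_gt0 : (0 < n)%N <-> [set: M] <> [set 0].
Proof.
rewrite -filtT; split=> [n0|ne].
  by move=> fn; have [_] := filt_lt n0 (leqnn _); rewrite fn => /(_ (@subset_refl _ _)).
by rewrite lt0n; apply/eqP => n0; apply: ne; rewrite n0.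
Qed.

Lemma uni_sums U V : submodule U -> submodule V -> sums U V = setT ->
  U = setT \/ V = setT.
Proof.
move=> sU sV UV; have [le|le] := uni_total sU sV; [right|left].
  rewrite -subTset -UV => x [u Uu Vu]; rewrite -[x](subrK u).
  by apply: (subD sV) => //; exact: le.
rewrite -subTset -UV => x [u Uu Vu]; rewrite -[x](subrK u).
by apply: (subD sU) => //; exact: le.
Qed.

Lemma uni_disj U V : submodule U -> submodule V -> U `&` V `<=` [set 0] ->
  U = [set 0] \/ V = [set 0].
Proof.
move=> sU sV UV; have [le|le] := uni_total sU sV; [left|right].
  by apply: sub_eq0 => // x Ux; apply: UV; split=> //; exact: le.
by apply: sub_eq0 => // x Ux; apply: UV; split=> //; exact: le.
Qed.

Lemma uni_cyc : exists x : M, cyc x = setT.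
Proof.
have [n0|n0] := posnP n.
  by exists 0; apply/seteqP; split=> // x _; exists 0; rewrite // [RHS](uni0 n0) scaler0.
have [|_] := @filt_lt n.-1 n _ (leqnn n); first by lia.
move=> /existsNP[x] /not_implyP[_ nx].
exists x; have [//|ne] := pselect (cyc x = setT).
by case: nx; apply: (uni_proper (submodule_cyc x) ne); exact: cyc_id.
Qed.

End Theory.

(** The way to recognize a uniserial module: any strict chain that exhausts the
submodules is the canonical filtration. *)
Lemma uniI M n (F : nat -> set M) : F 0%N = [set 0] -> F n = setT ->
  (forall k, submodule (F k)) -> (forall k, (k < n)%N -> F k `<` F k.+1) ->
  (forall U, submodule U -> exists2 k, (k <= n)%N & U = F k) ->
  uniserial M n /\ forall k, (k <= n)%N -> filt M k = F k.
Proof.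
move=> F0 Fn sF Flt FU.
have Fle i j : (i <= j)%N -> (j <= n)%N -> F i `<=` F j.
  move=> /subnK <-; elim: (j - i)%N => [|k IH]; first by move=> _ x; rewrite add0n.
  rewrite addSn => kn.
  apply: subset_trans (IH _) _; first by lia.
  by case: (Flt _ kn).
have flF k : (k <= n)%N -> filt M k = F k.
  elim: k => [|k IH] kn; first by rewrite F0.
  rewrite /= IH; last by lia.
  apply/seteqP; split=> x.
    by apply; split=> //; exact: Flt.
  move=> Fx U [/FU[j jn ->]] [_ njk]; apply: (Fle k.+1) => //.
  by rewrite ltnNge; apply/negP => jk; apply: njk; apply: Fle => //; lia.
split=> //; split=> [|k kn|U /FU[k kn ->]]; first by rewrite flF.
  by rewrite !flF; [exact: Flt|lia|lia].
by exists k => //; rewrite flF.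
Qed.

Lemma uni_uniq M n m : uniserial M n -> uniserial M m -> n = m.
Proof.
move=> un um; wlog nm : n m un um / (n <= m)%N.
  by move=> W; have [/W->|/ltnW/W->] := leqP n m.
apply/eqP; rewrite eqn_leq nm /=; apply: (filt_le um) => //.
by rewrite (filtT un).
Qed.

Lemma preimage_imageK M N (p : {linear M -> N}) (U : set M) : submodule U ->
  p @^-1` [set 0] `<=` U -> p @^-1` (p @` U) = U.
Proof.
move=> sU kU; apply/seteqP; split; last exact: preimage_image.
move=> x [y Uy pxy]; rewrite -[x](subrK y); apply: (subD sU) => //.
by apply: kU; rewrite /= linearB pxy subrr.
Qed.

Lemma image_preimageK M N (p : {linear M -> N}) (V : set N) : range p = setT ->
  p @` (p @^-1` V) = V.
Proof.
move=> pT; apply/seteqP; split; first exact: image_preimage_subset.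
by move=> y Vy; have /rangeTP/(_ y)[x xy] := pT; exists x => //=; rewrite xy.
Qed.

Lemma uni_quot M N n k (p : {linear M -> N}) : uniserial M n -> range p = setT ->
  (k <= n)%N -> p @^-1` [set 0] = filt M k ->
  uniserial N (n - k) /\
  forall j, (j <= n - k)%N -> p @^-1` (filt N j) = filt M (k + j).
Proof.
move=> uM pT kn kp.
have pK j : p @^-1` (p @` filt M (k + j)) = filt M (k + j).
  apply: preimage_imageK; first exact: submodule_filt.
  by rewrite kp; apply: filt_mono; exact: leq_addr.
have [||j|j jn|V sV|uN flN] := @uniI N (n - k) (fun j => p @` filt M (k + j)).
- rewrite addn0 -kp image_preimageK//.
- by rewrite subnKC// (filtT uM).
- exact/submodule_image/submodule_filt.
- have [||lt nlt] := @filt_lt _ _ uM (k + j)%N (k + j.+1)%N; [lia|lia|].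
  split; first exact: image_subset.
  move=> /(@preimage_subset _ _ p); rewrite !pK; exact: nlt.
- have [i iN iE] := filtE uM (submodule_preimage p sV).
  have ki : (k <= i)%N.
    apply: (filt_le uM) => //; rewrite -kp -iE => x /= ->; exact: sub0.
  exists (i - k)%N; first by lia.
  by rewrite subnKC// -iE image_preimageK.
by split=> // j jn; rewrite flN// pK.
Qed.

Lemma uni_sub M K n k (i : {linear K -> M}) : uniserial M n -> injective i ->
  (k <= n)%N -> range i = filt M k ->
  uniserial K k /\ forall j, (j <= k)%N -> i @` (filt K j) = filt M j.
Proof.
move=> uM ii kn ri.
have iK j : (j <= k)%N -> i @` (i @^-1` filt M j) = filt M j.
  move=> jk; apply/seteqP; split; first exact: image_preimage_subset.
  move=> x fx; have : range i x by rewrite ri; exact: filt_mono fx.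
  by case=> y _ yx; exists y => //=; rewrite yx.
have iK' (V : set K) : i @^-1` (i @` V) = V.
  apply/seteqP; split; last exact: preimage_image.
  by move=> x [y Vy /ii <-].
have [||j|j jn|V sV|uK flK] := @uniI K k (fun j => i @^-1` filt M j).
- exact/inj_ker.
- by rewrite -ri; apply/seteqP; split=> // x _; exists x.
- exact/submodule_preimage/submodule_filt.
- have [|lt nlt] := @filt_lt _ _ uM j j.+1 (leqnn _); [lia|].
  split; first exact: preimage_subset.
  move=> /(@image_subset _ _ i); rewrite !iK//; last exact: ltnW.
- have [j jn jE] := filtE uM (submodule_image i sV).
  have jk : (j <= k)%N.
    by apply: (filt_le uM) => //; rewrite -jE -ri; apply: image_subset.
  by exists j => //; rewrite -jE iK'.
by split=> // j jk; rewrite flK// iK.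
Qed.

Lemma uni_ker M N n m (p : {linear M -> N}) : uniserial M n -> uniserial N m ->
  range p = setT ->
  [/\ (m <= n)%N, p @^-1` [set 0] = filt M (n - m)
    & forall j, (j <= m)%N -> p @^-1` (filt N j) = filt M (n - m + j)].
Proof.
move=> uM uN pT; have [k kn kp] := filtE uM (submodule_ker p).
have [uN' flN] := uni_quot uM pT kn kp; rewrite (uni_uniq uN uN').
by rewrite subKn//; split=> //; lia.
Qed.

Lemma uni_range M K n m (i : {linear K -> M}) : uniserial M n -> uniserial K m ->
  injective i ->
  [/\ (m <= n)%N, range i = filt M m
    & forall j, (j <= m)%N -> i @` (filt K j) = filt M j].
Proof.
move=> uM uK ii; have [k kn kp] := filtE uM (submodule_range i).
have [uK' flK] := uni_sub uM ii kn kp.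
by move: (uni_uniq uK uK') => km; rewrite -km in kn kp flK *.
Qed.

Lemma uni_inj_surj M N n (f : {linear M -> N}) : uniserial M n -> uniserial N n ->
  injective f <-> range f = setT.
Proof.
move=> uM uN; split=> [fi|fT].
  by have [_ -> _] := uni_range uN uM fi; exact: filtT.
have [_ kf _] := uni_ker uM uN fT.
by apply/inj_ker; rewrite kf subnn.
Qed.

Lemma uni_iso M N n : isomorphic M N -> uniserial M n -> uniserial N n.
Proof.
case/isoP=> f [fi fT] uM.
have [uN _] := @uni_quot _ _ _ 0%N f uM fT (leq0n _) ((inj_ker f).1 fi).
by move: uN; rewrite subn0.
Qed.

Lemma filt_quo M n k : uniserial M n -> (k <= n)%N ->
  exists N (p : {linear M -> N}),
  [/\ range p = setT, p @^-1` [set 0] = filt M k & uniserial N (n - k)].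
Proof.
move=> uM kn; have [N [p [pT kp]]] := quo_exists (@submodule_filt M k).
by exists N, p; split=> //; have [] := uni_quot uM pT kn kp.
Qed.

Lemma filt_sub M n k : uniserial M n -> (k <= n)%N ->
  exists K (i : {linear K -> M}), [/\ injective i, range i = filt M k & uniserial K k].
Proof.
move=> uM kn; have [N [i [ii ri]]] := sub_exists (@submodule_filt M k).
by exists N, i; split=> //; have [] := uni_sub uM ii kn ri.
Qed.

Lemma simple_uni S : simple_module S <-> uniserial S 1.
Proof.
split=> [[S0 sS]|uS]; last first.
  split; first exact/(uni_gt0 uS).
  move=> U /(filtE uS)[[|[|//]] _ ->]; [by left|right; exact: filtT].
have [||k|[|//] _|U sU|//] := @uniI S 1 (fun k => if k is 0%N then [set 0] else setT) => //.
- by case: k => [|k]; [exact: submodule0|exact: submoduleT].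
- by split=> // T0; apply: S0; apply/seteqP; split.
- by have [->|->] := sS U sU; [exists 0%N | exists 1%N].
Qed.

Lemma uni_maximal M n k : uniserial M n -> (k < n)%N ->
  maximal_in (filt M k) (filt M k.+1).
Proof.
move=> uM kn; split; first exact: (filt_lt uM).
move=> W /(filtE uM)[j jn ->] kj jk.
have kj' : (k <= j)%N by apply: (filt_le uM) => //; lia.
have jk' : (j <= k.+1)%N by exact: (filt_le uM).
by move: jk'; rewrite leq_eqVlt => /predU1P[->|?]; [right|left; congr filt; lia].
Qed.

Lemma radicalE M n : uniserial M n.+1 -> @radical _ M = filt M n.
Proof.
move=> uM; apply/seteqP; split=> [x|x fx U [sU [[_ nU] mU]]].
  apply; split; first exact: submodule_filt.
  by rewrite -(filtT uM); exact: uni_maximal uM _.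
have [k kn UE] := filtE uM sU; move: nU mU; rewrite UE => nU mU.
have [nk|kn'] := leqP n k; first exact: filt_mono fx.
have [|| |nk|nT] := mU (filt M n).
- exact: submodule_filt.
- by apply: filt_mono; exact: ltnW.
- by [].
- by move: kn'; rewrite (filt_inj uM _ _ nk) ?ltnn//; lia.
- by have [_] := filt_lt uM (ltnSn n) (leqnn _); rewrite nT => /(_ (@subsetT _ _)).
Qed.

Lemma socleE M n : uniserial M n.+1 -> @socle _ M = filt M 1.
Proof.
move=> uM; apply/seteqP; split=> [x|x fx U [sU VU]].
  apply; split; first exact: submodule_filt.
  move=> V sV [[_ nV] mV]; have [| | |E|->] := mV (filt M 1).
  - exact: submodule_filt.
  - by move=> y ->; exact: (sub0 (submodule_filt M 1)).
  - apply: (uni_nz uM) => // V0; apply: nV; rewrite V0; exact: subset_refl.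
  - by have [_] := @filt_lt _ _ uM 0 1 isT isT; rewrite E => /(_ (@subset_refl _ _)).
  - exact: subset_refl.
by apply: (VU (filt M 1)) => //; [exact: submodule_filt|exact: (@uni_maximal _ _ 0%N uM)].
Qed.

End Uniserial.
Arguments filt {R} M k.

(** * Unique composition series *)
Section Serial.
Variable R : pzRingType.
Variable M : lmodType R.
Implicit Types U V W X : set M.

Lemma maximal_inI U W V : submodule U -> submodule W -> submodule V ->
  maximal_in W V -> W `&` U = V `&` U \/ maximal_in (W `&` U) (V `&` U).
Proof.
move=> sU sW sV [[WV nWV] mWV].
have [->|ne] := pselect (W `&` U = V `&` U); [by left|right].
have IWV : W `&` U `<=` V `&` U by exact: setSI.
split; first by split=> // VW; apply: ne; apply/seteqP.
move=> X sX WX XV; have [|||XW|XW] := mWV (sums W X).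
- exact: submodule_sums.
- exact: sumsl.
- move=> x [w Ww Xxw]; rewrite -[x](subrK w); apply: (subD sV); last exact: WV.
  by case: (XV _ Xxw).
- left; apply/seteqP; split=> // x Xx; split; last by case: (XV _ Xx).
  by rewrite -XW; exact: sumsr.
- right; apply/seteqP; split=> // v [Vv Uv].
  have : sums W X v by rewrite XW.
  case=> w Ww Xvw; rewrite -[v](subrK w); apply: (subD sX) => //.
  apply: WX; split=> //.
  have -> : w = v - (v - w) by rewrite opprB addrC subrK.
  by apply: (subB sU) => //; case: (XV _ Xvw).
Qed.

Lemma maximal_inD U W V : submodule U -> submodule W -> submodule V ->
  maximal_in W V -> sums W U = sums V U \/ maximal_in (sums W U) (sums V U).
Proof.
move=> sU sW sV [[WV nWV] mWV].
have [->|ne] := pselect (sums W U = sums V U); [by left|right].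
have IWV : sums W U `<=` sums V U by move=> x [w Ww ?]; exists w => //; exact: WV.
split; first by split=> // VW; apply: ne; apply/seteqP.
move=> X sX WX XV.
have UX : U `<=` X by apply: subset_trans WX; exact: sumsr.
have [|||XW|XW] := mWV (V `&` X).
- exact: submoduleI.
- by move=> w Ww; split; [exact: WV | apply: WX; exact: sumsl].
- by move=> x [].
- left; apply/seteqP; split=> // x Xx; have [v Vv Uxv] := XV _ Xx.
  exists v => //; rewrite -XW; split=> //.
  have -> : v = x - (x - v) by rewrite opprB addrC subrK.
  by apply: (subB sX) => //; exact: UX.
- right; apply/seteqP; split=> // x [v Vv Uxv]; rewrite -[x](subrK v).
  apply: (subD sX); first exact: UX.
  by have [] : (V `&` X) v by rewrite XW.
Qed.

(** Composition series between two submodules; unlike [simple_chain], the upper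
end is a parameter, so that series can be concatenated. *)
Fixpoint spath U (s : seq (set M)) V : Prop :=
  if s is W :: s' then [/\ submodule W, maximal_in U W & spath W s' V]
  else U = V.

Lemma spath_cat U V W s t : spath U s V -> spath V t W -> spath U (s ++ t) W.
Proof.
elim: s U => [|X s IH] U /=; first by move=> ->.
by case=> sX UX XV VW; split=> //; exact: IH.
Qed.

Lemma spathT U s : simple_chain U s <-> spath U s setT.
Proof. by elim: s U => [|X s IH] U //=; split=> -[? ? /IH]. Qed.

Lemma spathI W U s V : submodule W -> submodule U -> spath W s V ->
  exists t, spath (W `&` U) t (V `&` U).
Proof.
move=> + sU; elim: s W => [|X s IH] W sW /=; first by move=> ->; exists [::].
case=> sX WX /(IH _ sX)[t ht].
have [->|m] := maximal_inI sU sW sX WX; first by exists t.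
by exists (X `&` U :: t); split=> //; exact: submoduleI.
Qed.

Lemma spathD W U s V : submodule W -> submodule U -> spath W s V ->
  exists t, spath (sums W U) t (sums V U).
Proof.
move=> + sU; elim: s W => [|X s IH] W sW /=; first by move=> ->; exists [::].
case=> sX WX /(IH _ sX)[t ht].
have [->|m] := maximal_inD sU sW sX WX; first by exists t.
by exists (sums X U :: t); split=> //; exact: submodule_sums.
Qed.

Lemma spath_last U s V : spath U s V -> nth setT (U :: s) (size s) = V.
Proof. by elim: s U => [|X s IH] U //= [_ _ /IH]. Qed.

Lemma spath_lt U s V k : spath U s V -> (k < size s)%N ->
  nth setT (U :: s) k `<` nth setT (U :: s) k.+1.
Proof.
elim: s U k => [|X s IH] U k //= [_ [lt _] h]; case: k => [|k] //.
by rewrite ltnS => /(IH _ _ h).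
Qed.

Lemma spath_sub U s V k : submodule U -> spath U s V ->
  submodule (nth setT (U :: s) k).
Proof.
elim: s U k => [|X s IH] U k sU /=.
  by move=> _; case: k => [|[|k]] //=; exact: submoduleT.
by case=> sX _ h; case: k => [|k] //=; exact: IH.
Qed.

(** Intersecting the given series with a submodule U, and adding U to it, gives
a composition series that passes through U. By uniqueness this is the given
series, so U is one of its terms. *)
Lemma serial_uni : serial M -> exists n, uniserial M n.
Proof.
case=> s [/spathT cs us]; exists (size s).
have [] := @uniI _ M (size s) (nth setT ([set 0] :: s)) => //.
- exact: spath_last cs.
- by move=> k; exact: spath_sub (@submodule0 _ M) cs.
- by move=> k; exact: spath_lt cs.
move=> U sU.
have [s1 h1] := spathI (@submodule0 _ M) sU cs.
have [s2 h2] := spathD (@submodule0 _ M) sU cs.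
have E0 : [set 0] `&` U = [set 0].
  by apply/seteqP; split=> [x []|x ->] //; split=> //; exact: sub0.
have E1 : sums [set 0] U = U.
  by apply/seteqP; split=> [x [y ->]|]; [rewrite subr0|apply: sumsr; exact: submodule0].
have E2 : sums setT U = setT.
  by apply/seteqP; split=> // x _; exact: sumsl.
rewrite E0 setTI in h1; rewrite E1 E2 in h2.
have /us -> : composition_series (s1 ++ s2) by apply/spathT; exact: spath_cat h1 h2.
exists (size s1); first by rewrite size_cat leq_addr.
rewrite -(spath_last h1) -cat_cons nth_cat /= ltnSn.
by [].
Qed.
End Serial.

(** * The regular module *)
Section ArtinAlgebra.
Variable A : pzRingType.
Implicit Types M N K P Q : lmodType A.

Definition dcc := forall J : nat -> set A^o, (forall n, submodule (J n)) ->
  (forall n, J n.+1 `<=` J n) -> exists m, forall n, (m <= n)%N -> J n = J m.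

(** For each generator g i, the leading coefficients of the elements of J m that
involve only the generators up to g i form an ideal of the base ring. These
finitely many chains of ideals become stationary at a common m0, and from there
on an element of J m0 is brought into J m one generator at a time. *)
Lemma artin_dcc : artin_algebra A -> dcc.
Proof.
case=> k [phi [ak _ [r [g gE]]]] J sJ dJ.
have dJ' m n : (m <= n)%N -> J n `<=` J m.
  move=> /subnK <-; elim: (n - m)%N => [|i IH]; first by move=> x; rewrite add0n.
  by rewrite addSn; exact: subset_trans (dJ _) IH.
pose Sp i (x : A) := exists d : 'I_r -> k,
  x = \sum_(j < r | (j < i)%N) phi (d j) * g j.
have SpL i c x y : Sp i x -> Sp i y -> Sp i (phi c * x + y).
  case=> [d ->] [d' ->]; exists (fun j => c * d j + d' j).
  rewrite mulr_sumr -big_split; apply: eq_bigr => j _ /=.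
  by rewrite rmorphD rmorphM mulrDl mulrA.
pose K (i : 'I_r) m : set k^o := [set c | exists2 x, J m x & Sp i (x - phi c * g i)].
have sK i m : submodule (K i m).
  apply/submoduleP; split.
    exists 0; first exact: sub0.
    by exists (fun=> 0); rewrite rmorph0 mul0r subrr big1// => j _; rewrite ?rmorph0 mul0r.
  move=> a c d [x Jx Sx] [y Jy Sy]; exists (phi a * x + y); first exact: (subL (sJ m)).
  have := SpL _ a _ _ Sx Sy; congr (Sp _ _).
  by rewrite rmorphD rmorphM mulrBr mulrDl mulrA opprD addrACA.
have dK i m : K i m.+1 `<=` K i m by move=> c [x /dJ Jx Sx]; exists x.
pose mm i := projT1 (cid (ak _ (sK i) (dK i))).
have mmE i n : (mm i <= n)%N -> K i n = K i (mm i).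
  by rewrite /mm; case: cid => /= m; exact.
pose m0 := (\max_(i < r) mm i)%N.
exists m0 => m m0m; apply/seteqP; split; first exact: dJ'.
move=> x Jx.
(* H: modulo J m, x can be written without the last i generators. *)
suff H i : (i <= r)%N -> exists2 y, J m y & Sp (r - i)%N (x - y).
  have [|y Jy] := H r; first by [].
  rewrite subnn => -[d]; rewrite big_pred0 => [/subr0_eq ->|] //.
elim: i => [_|i IH ir].
  exists 0; first exact: sub0; rewrite subn0 subr0.
  have [d dE] := gE x; exists d; rewrite dE.
  by apply: eq_bigl => j; rewrite ltn_ord.
have [|y Jy [d dE]] := IH; first by lia.
have ri : (r - i.+1 < r)%N by lia.
pose o := Ordinal ri.
have oE : (r - i = o.+1)%N by rewrite /=; lia.
have dE' : x - y = phi (d o) * g o + \sum_(j < r | (j < o)%N) phi (d j) * g j.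
  rewrite dE (bigD1 o)/=; last by rewrite oE.
  congr (_ + _); apply: eq_bigl => j; rewrite -val_eqE /= -ltnS.
  by rewrite [in LHS]ltnS oE ltnS ltn_neqAle andbC.
have : K o m0 (d o).
  exists (x - y); first by apply: (subB (sJ _)) => //; exact: dJ' m0m _ Jy.
  by exists d; rewrite dE' addrC addKr.
rewrite (mmE _ m0) ?leq_bigmax// -(mmE _ m); last first.
  by apply: leq_trans m0m; exact: leq_bigmax.
case=> z Jz Sz; exists (y + z); first exact: (subD (sJ m)).
have Sy : Sp o (x - y - phi (d o) * g o) by exists d; rewrite dE' addrC addKr.
have := SpL _ (-1) _ _ Sz Sy; congr (Sp _ _).
by rewrite rmorphN1 mulN1r opprB addrC addrA subrK -addrA -opprD.
Qed.

Lemma dcc_min (F : set A^o -> Prop) : dcc -> (forall U, F U -> submodule U) ->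
  (exists U, F U) -> exists2 U, F U & forall V, F V -> V `<=` U -> V = U.
Proof.
move=> dc sF [U0 FU0]; apply: contrapT => nm.
have next (U : {U | F U}) : exists V : {U | F U}, sval V `<=` sval U /\ sval V <> sval U.
  case: U => U FU /=; apply: contrapT => nV; apply: nm; exists U => // V FV VU.
  by apply: contrapT => VneU; apply: nV; exists (exist _ V FV).
pose f U := projT1 (cid (next U)).
have fP U : sval (f U) `<=` sval U /\ sval (f U) <> sval U by rewrite /f; case: cid.
pose J n := iter n f (exist _ U0 FU0).
have [n||m mE] := dc (fun n => sval (J n)).
- by apply: sF; exact: svalP.
- by move=> n; case: (fP (J n)).
- by case: (fP (J m)) => _; apply; exact: (mE m.+1 (leqnSn m)).
Qed.

Lemma projective_reg : projective A^o.
Proof.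
move=> M N g f /rangeTP gT; have [m gm] := gT (f 1).
have [|f' f'E] := @linear_of _ A^o M (fun a => a *: m).
  by move=> a x y; rewrite scalerDl -scalerA.
exists f' => a; rewrite /= f'E linearZ gm -linearZ; congr (f _).
exact: mulr1.
Qed.

Lemma projective_retract P Q (i : {linear P -> Q}) (r : {linear Q -> P}) :
  cancel i r -> projective Q -> projective P.
Proof.
move=> ir pQ M N g f gT; have [h hE] := pQ M N g (f \o r) gT.
by exists (h \o i) => x /=; have /= -> := hE (i x); rewrite ir.
Qed.

(** The module D is contained in the sum of the images of all maps from finitely
many uniserial projective modules; stated by testing submodules, so that no
sums over families of maps have to be formed. *)
Definition reached (D : set A^o) := exists (I : finType) (Q : I -> lmodType A),
  (forall i, projective (Q i) /\ exists n, uniserial (Q i) n) /\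
  forall U : set A^o, submodule U ->
    (forall i (f : {linear Q i -> A^o}), range f `<=` U) -> D `<=` U.

Lemma reachedU (D D1 D2 : set A^o) : D `<=` sums D1 D2 -> reached D1 -> reached D2 -> reached D.
Proof.
move=> DD [I1 [Q1 [h1 g1]]] [I2 [Q2 [h2 g2]]].
exists (I1 + I2)%type, (fun i => match i with inl i => Q1 i | inr i => Q2 i end).
split; first by case.
move=> U sU QU x /DD[y D1y D2y]; rewrite -[x](subrK y); apply: (subD sU).
  by apply: (g2 U) => // i f; exact: (QU (inr i)).
by apply: (g1 U) => // i f; exact: (QU (inl i)).
Qed.

Hypothesis dc : dcc.
Hypothesis ser : forall M, fin_gen M -> indecomposable M -> serial M.

Lemma indec_uni M : fin_gen M -> indecomposable M -> exists n, uniserial M n.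
Proof. by move=> fM iM; apply/serial_uni/ser. Qed.

Lemma not_indec M : [set: M] <> [set 0] -> ~ indecomposable M ->
  exists U V : set M, [/\ submodule U, submodule V, U `&` V = [set 0],
    sums U V = setT & U <> [set 0] /\ V <> [set 0]].
Proof.
move=> M0 nM; apply: contrapT => nUV; apply: nM; split=> // U V sU sV UV sUV.
apply: contrapT => /not_orP[U0 V0]; apply: nUV; exists U, V; split=> //.
by apply/seteqP; split=> // x _; exact: sUV.
Qed.

Lemma reg_reached : reached setT.
Proof.
apply: contrapT => nr.
(* A minimal counterexample among the direct summands of the regular module is
   neither zero nor indecomposable, so it splits into two smaller ones. *)
pose F D := exists K (i : {linear K -> A^o}) (r : {linear A^o -> K}),
  [/\ cancel i r, range i = D & ~ reached D].
have [||D [K [i [r [ir ri nD]]]] mD] := @dcc_min F dc.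
- by move=> _ [K [i [r [_ <- _]]]]; exact: submodule_range.
- exists setT, A^o, idfun, idfun; split=> //.
  by apply/seteqP; split=> // x _; exists x.
have fK : fin_gen K.
  exists 1%N, (fun=> r 1) => x; exists (fun=> i x); rewrite big_ord1 -linearZ.
  by rewrite -[LHS]ir; congr (r _); rewrite -[LHS]mulr1.
have [K0|K0] := pselect ([set: K] = [set 0]).
  apply: nD; exists void, (fun=> K); split; first by case.
  move=> U sU _ x; rewrite -ri => -[y _ <-].
  have : [set: K] y by []. rewrite K0 => ->; rewrite linear0; exact: sub0.
have [iK|nK] := pselect (indecomposable K).
  apply: nD; exists unit, (fun=> K); split.
    by move=> _; split; [exact: projective_retract ir projective_reg|exact: indec_uni].
  by move=> U sU /(_ tt i); rewrite ri.
have part (U V : set K) : submodule U -> submodule V -> U `&` V `<=` [set 0] ->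
    sums U V = setT -> V <> [set 0] -> reached (i @` U).
  move=> sU sV UV UVT V0; apply: contrapT => nU.
  have [p [pU rp _]] := proj_exists sU sV UV UVT.
  have [L [j [ji rj]]] := sub_exists sU.
  have [p' p'E] : exists p' : {linear K -> L}, forall x, j (p' x) = p x.
    by apply: lift_inj => //; rewrite rp rj.
  have DE : i @` U = D.
    apply: mD; last by rewrite -ri => _ [x _ <-]; exists x.
    exists L, (i \o j), (p' \o r); split=> //.
      by move=> x /=; rewrite ir; apply: ji; rewrite p'E pU// -rj; exists x.
    by rewrite -rj image_comp.
  apply: V0; apply: sub_eq0 => // x Vx; apply: UV; split=> //.
  have : D (i x) by rewrite -ri; exists x.
  by rewrite -DE => -[y Uy /(can_inj ir) <-].
have [U [V [sU sV UV UVT [U0 V0]]]] := not_indec K0 nK.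
apply: nD; apply: (@reachedU _ (i @` U) (i @` V)).
- move=> z; rewrite -ri => -[x _ <-].
  have : [set: K] x by []; rewrite -UVT => -[u Uu Vu].
  by exists (i u); [exists u | exists (x - u); rewrite ?linearB].
- by apply: part V0 => //; rewrite UV.
- apply: part U0 => //; first by rewrite setIC UV.
  rewrite -subTset -UVT => x [u Uu Vu]; exists (x - u) => //.
  by rewrite opprB addrC subrK.
Qed.

End ArtinAlgebra.

(** * An injectivity criterion *)
Section Injectivity.
Variable A : pzRingType.
Implicit Types M N K P Q J X : lmodType A.

(** Nonzero quotients contain simple submodules; this replaces transfinite
ascent in the extension argument by single steps with simple quotient. *)
Definition above_maximal := forall N (D : set N), submodule D -> D <> setT ->
  exists2 D', submodule D' & maximal_in D D'.

(** J is injective as soon as every extension of a simple module by J splits.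
A partial extension of a map to J is maximal by Zorn's lemma, applied to graphs.
If its domain D were proper, D' / D would be simple for some D', and the pushout
of J along the inclusion of D in D' would be an extension of a simple module by
J; its retraction extends the map to D'. *)
Lemma maximal_split_injective J : above_maximal ->
  (forall X (j : {linear J -> X}), injective j -> maximal_in (range j) setT ->
     exists r : {linear X -> J}, cancel j r) ->
  injective_module J.
Proof.
move=> abv split_J M N g f gi.
pose good (G : set (N * J)) := [/\ submodule G, forall y, G (0, y) -> y = 0
  & forall x, G (g x, f x)].
have good_sub G : good G -> submodule G by case.
(* The empty graph is allowed because the union of the empty chain is empty. *)
have [F FP tF|G [PG mG]] := @Zorn_bigcup _ (fun G => G = set0 \/ good G).
  have [[G0 FG0 G0ne]|nG] := pselect (exists2 G, F G & G <> set0); last first.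
    left; apply/seteqP; split=> // z [G FG Gz].
    by case: nG; exists G => // E; rewrite E in Gz.
  right; have gF G z : F G -> G z -> good G.
    by move=> FG Gz; have [E|//] := FP _ FG; rewrite E in Gz.
  have gG0 : good G0 by have [] := FP _ FG0.
  split.
  - apply/submoduleP; split; first by exists G0 => //; exact: (sub0 (good_sub _ gG0)).
    move=> a x y [G1 FG1 G1x] [G2 FG2 G2y].
    have [/(_ _ G1x) G2x|/(_ _ G2y) G1y] := tF _ _ FG1 FG2.
      by exists G2 => //; apply: subL => //; exact: good_sub _ (gF _ _ FG2 G2y).
    by exists G1 => //; apply: subL => //; exact: good_sub _ (gF _ _ FG1 G1x).
  - by move=> y [G FG Gy]; have [_ + _] := gF _ _ FG Gy; exact.
  - by move=> x; exists G0 => //; case: gG0.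
have gG : good G.
  case: PG => // G0; exfalso.
  pose B := range (fun x => (g x, f x)).
  apply: (mG B); first by rewrite G0; split=> // /(_ (g 0, f 0)); apply; exists 0.
  right; split.
  - apply/submoduleP; split; first by exists 0; rewrite // !linear0.
    by move=> a _ _ [x _ <-] [y _ <-]; exists (a *: x + y); rewrite // !linearP.
  - by move=> y [x _ [gx <-]]; rewrite (gi x 0) ?linear0.
  - by move=> x; exists x.
have [sG fG bG] := gG.
have Gfun n y y' : G (n, y) -> G (n, y') -> y = y'.
  move=> Gy Gy'; apply/subr0_eq/fG.
  by have := subB sG Gy Gy'; congr G; congr pair; rewrite /= subrr.
pose D : set N := [set n | exists y, G (n, y)].
have sD : submodule D.
  apply/submoduleP; split; first by exists 0; exact: sub0 sG.
  move=> a n n' [y Gy] [y' Gy']; exists (a *: y + y'); exact: (subL sG a Gy Gy').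
have DT : D = setT; last first.
  have DP n : exists y, G (n, y) by have : D n by rewrite DT.
  pose h n := projT1 (cid (DP n)).
  have hP n : G (n, h n) by rewrite /h; case: cid.
  have [|h' h'E] := @linear_of _ _ _ h.
    move=> a x y; apply: Gfun (hP _) _; exact: (subL sG a (hP x) (hP y)).
  by exists h' => x; rewrite /= h'E; apply: Gfun (bG x).
apply: contrapT => DnT; have [D' sD' mD'] := abv _ _ sD DnT.
have [[DD' nD'D] maxD'] := mD'.
have [N2 [i2 [i2i ri2]]] := sub_exists sD'.
(* The pushout is the quotient of N2 * J by G', the graph with its second
   component negated. *)
pose G' : set (N2 * J) := [set z | G (i2 z.1, - z.2)].
have sG' : submodule G'.
  apply/submoduleP; split; first by rewrite /G' /= linear0 oppr0; exact: sub0 sG.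
  move=> a x y Gx Gy; have := subL sG a Gx Gy.
  by congr G; congr pair; rewrite /= ?linearP// opprD scalerN.
have [X [p [pT kp]]] := quo_exists sG'.
have [|j jE] := @linear_of _ J X (fun y => p (0, y)).
  move=> a x y; rewrite -linearP; congr (p _); congr pair.
  by rewrite /= scaler0 addr0.
have [|l lE] := @linear_of _ N2 X (fun n => p (n, 0)).
  move=> a x y; rewrite -linearP; congr (p _); congr pair.
  by rewrite /= scaler0 addr0.
have pE n y : p (n, y) = l n + j y.
  rewrite lE jE -linearD; congr (p _); congr pair; first by rewrite /= addr0.
  by rewrite /= add0r.
have p0 n y : l n + j y = 0 <-> G (i2 n, - y).
  rewrite -pE; have -> : (p (n, y) = 0) = ((p @^-1` [set 0]) (n, y)) by [].
  by rewrite kp.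
have ji : injective j.
  apply: inj_ker0 => y jy; apply: oppr_inj; rewrite oppr0; apply: fG.
  by have /p0 : l 0 + j y = 0 by [rewrite linear0 add0r]; rewrite linear0.
have [|r jr] := split_J X j ji.
  split.
    split=> // Tj; apply: nD'D; rewrite -ri2 => _ [n _ <-].
    have [y _ jy] := Tj (l n) I; exists (- - y); apply/p0.
    by rewrite linearN jy subrr.
  move=> W sW jW _.
  have sW' : submodule (i2 @` (l @^-1` W)).
    exact/submodule_image/submodule_preimage.
  have [||WE|WE] := maxD' _ sW'.
  - move=> n Dn; have [y Gy] := Dn; have : range i2 n by rewrite ri2; exact: DD'.
    case=> m _ mn; exists m => //=.
    have /p0/eqP : G (i2 m, - - y) by rewrite opprK mn.
    rewrite linearN subr_eq0 => /eqP ->; apply: jW; by exists y.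
  - by rewrite -ri2; apply: image_subset.
  - left; apply/seteqP; split=> // x Wx; have /rangeTP/(_ x)[[n y] nyx] := pT.
    rewrite pE in nyx.
    have : (i2 @` (l @^-1` W)) (i2 n).
      exists n => //=; apply: (subDr sW (y := j y)); last by rewrite nyx.
      by apply: jW; exists y.
    rewrite WE => -[y' Gy']; exists (y' + y) => //.
    rewrite -nyx linearD; congr (_ + _); apply/esym/subr0_eq.
    by rewrite -linearN; apply/p0; rewrite opprK.
  - right; apply/seteqP; split=> // x _; have /rangeTP/(_ x)[[n y] <-] := pT.
    rewrite pE; apply: (subD sW); last by apply: jW; exists y.
    have : (i2 @` (l @^-1` W)) (i2 n) by rewrite WE -ri2; exists n.
    by case=> m /= Wm /i2i <-.
pose G2 : set (N * J) := range (fun n => (i2 n, r (l n))).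
have GG2 : G `<=` G2.
  move=> [n y] Gny; have : range i2 n by rewrite ri2; apply: DD'; exists y.
  case=> m _ mn; exists m => //; rewrite mn; congr pair.
  have /p0/eqP : G (i2 m, - - y) by rewrite opprK mn.
  by rewrite linearN subr_eq0 => /eqP ->; rewrite jr.
apply: (mG G2); first split=> // G2G.
  apply: nD'D; rewrite -ri2 => _ [n _ <-]; exists (r (l n)); apply: G2G.
  by exists n.
right; split; last by move=> x; apply: GG2.
- apply/submoduleP; split; first by exists 0; rewrite // !linear0.
  by move=> a _ _ [x _ <-] [y _ <-]; exists (a *: x + y); rewrite // !linearP.
- move=> y [x _ [i2x <-]]; have -> : x = 0 by apply: i2i; rewrite i2x linear0.
  by rewrite !linear0.
Qed.

End Injectivity.

(** * Uniqueness of covers and envelopes, minimal resolutions *)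
Section Covers.
Variable A : pzRingType.
Implicit Types M N K P Q J I X Y C V : lmodType A.

Lemma choose_moduleP (F : lmodType A -> Prop) M :
  (exists N, F N) -> F (choose_module F M).
Proof.
move=> exF; rewrite /choose_module.
by case: pselect => // exF'; case: (cid exF').
Qed.

Lemma uni_surj_ker M N n m (f : {linear M -> N}) : uniserial M n -> uniserial N m ->
  (0 < m)%N -> range f = setT -> f @^-1` [set 0] <> setT.
Proof.
move=> uM uN m0 fT kT; apply: ((uni_gt0 uN).1 m0).
apply/seteqP; split=> // y _; have /rangeTP/(_ y)[x <-] := fT.
have : [set: M] x by [].
by rewrite -kT.
Qed.

Lemma uni_proj_cover P M l m (f : {linear P -> M}) : projective P -> uniserial P l ->
  uniserial M m -> (0 < m)%N -> range f = setT -> projective_cover f.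
Proof.
move=> pP uP uM m0 fT; split=> // U sU UV.
have [|//|kT] := uni_sums uP sU (submodule_ker f).
  by apply/seteqP; split=> // x _; exact: UV.
by case: (uni_surj_ker uP uM m0 fT).
Qed.

Lemma cover_unique P Q M (p : {linear P -> M}) (q : {linear Q -> M}) :
  projective_cover p -> projective_cover q ->
  exists h : {linear P -> Q}, [/\ injective h, range h = setT & forall x, q (h x) = p x].
Proof.
case=> pP pT sp [pQ qT sq].
have [h hE] := pP _ _ q p qT; have {}hE x : q (h x) = p x := hE x.
have hT : range h = setT.
  apply: sq; first exact: submodule_range.
  move=> x; have /rangeTP/(_ (q x))[y yE] := pT.
  by exists (h y); [exists y | rewrite /= linearB hE yE subrr].
have [g gE] := pQ _ _ h idfun hT; have {}gE x : h (g x) = x := gE x.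
have gT : range g = setT.
  apply: sp; first exact: submodule_range.
  move=> x; exists (g (h x)); first by exists (h x).
  by rewrite /= linearB -!hE gE subrr.
exists h; split=> //; apply: inj_ker0 => x.
by have /rangeTP/(_ x)[y <-] := gT; rewrite gE => ->; rewrite linear0.
Qed.

Lemma uni_inj_envelope J M l m (j : {linear M -> J}) : injective_module J ->
  uniserial J l -> uniserial M m -> (0 < m)%N -> injective j -> injective_envelope j.
Proof.
move=> iJ uJ uM m0 ji; split=> // U sU UV.
have [|r0|//] := uni_disj uJ (submodule_range j) sU; first by rewrite UV.
case: ((uni_gt0 uM).1 m0); apply/seteqP; split=> // x _.
apply: ji; rewrite linear0; have : range j (j x) by exists x.
by rewrite r0.
Qed.

Lemma envelope_unique I J M (i : {linear M -> I}) (j : {linear M -> J}) :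
  injective_envelope i -> injective_envelope j ->
  exists h : {linear I -> J}, [/\ injective h, range h = setT & forall x, h (i x) = j x].
Proof.
case=> iI ii ei [iJ ji ej].
have [h hE] := iJ _ _ i j ii; have {}hE x : h (i x) = j x := hE x.
have hi : injective h.
  apply/inj_ker/ei; first exact: submodule_ker.
  apply/seteqP; split=> [_ [[x _ <-]]|x ->] /=.
    by rewrite hE => jx; rewrite (ji x 0) ?linear0.
  by split; [exact: sub0 (submodule_range i)|rewrite /= linear0].
have [g gE] := iI _ _ h idfun hi; have {}gE x : g (h x) = x := gE x.
have gi : injective g.
  apply/inj_ker/ej; first exact: submodule_ker.
  apply/seteqP; split=> [_ [[x _ <-]]|x ->] /=.
    by rewrite -hE gE => ix; rewrite ix linear0.
  by split; [exact: sub0 (submodule_range j)|rewrite /= linear0].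
exists h; split=> //; apply/rangeTP => y; exists (g y); apply: gi; exact: gE.
Qed.

Lemma uni_inj_split I V m n (j : {linear I -> V}) : injective_module I ->
  uniserial I m -> (0 < m)%N -> uniserial V n -> injective j -> range j = setT.
Proof.
move=> iI uI m0 uV ji.
have [r rE] := iI _ _ j idfun ji; have {}rE x : r (j x) = x := rE x.
have [|//|kT] := uni_sums uV (submodule_range j) (submodule_ker r).
  apply/seteqP; split=> // x _; exists (j (r x)); first by exists (r x).
  by rewrite /= linearB rE subrr.
have rT : range r = setT by apply/rangeTP => x; exists (j x).
by case: (uni_surj_ker uV uI m0 rT).
Qed.

Lemma uni_proj_split P V m n (f : {linear V -> P}) : projective P ->
  uniserial P m -> (0 < m)%N -> uniserial V n -> range f = setT -> injective f.
Proof.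
move=> pP uP m0 uV fT.
have [r rE] := pP _ _ f idfun fT; have {}rE x : f (r x) = x := rE x.
have [|rT|kT] := uni_sums uV (submodule_range r) (submodule_ker f).
- apply/seteqP; split=> // x _; exists (r (f x)); first by exists (f x).
  by rewrite /= linearB rE subrr.
- apply: inj_ker0 => x; have /rangeTP/(_ x)[y <-] := rT.
  by rewrite rE => ->; rewrite linear0.
- by case: (uni_surj_ker uV uP m0 fT).
Qed.

(** For a uniserial module X of finite length an injective endomorphism is
bijective, so [uret X M] says that X is a direct summand of M. *)
Definition uret X M :=
  exists (u : {linear X -> M}) (v : {linear M -> X}), injective (v \o u).

Lemma uret_bij X M m : uniserial X m -> uret X M ->
  exists (u : {linear X -> M}) (v : {linear M -> X}), cancel u v.
Proof.
move=> uX [u [v vui]]; have vuT := (uni_inj_surj (v \o u) uX uX).1 vui.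
have [w [wK Kw]] := bij_inv vui vuT.
by exists u, (w \o v) => x; exact: wK.
Qed.

Lemma uret_refl M : uret M M.
Proof. by exists idfun, idfun => x y. Qed.

Lemma uret_projective X M m : uniserial X m -> uret X M -> projective M -> projective X.
Proof. by move=> uX /(uret_bij uX)[u [v uv]]; exact: projective_retract uv. Qed.

Lemma uret_injective X M m : uniserial X m -> uret X M -> injective_module M ->
  injective_module X.
Proof.
move=> uX /(uret_bij uX)[u [v uv]] iM N K g f gi.
have [h hE] := iM _ _ g (u \o f) gi.
by exists (v \o h) => x /=; have /= -> := hE x; rewrite uv.
Qed.

(** Passing from modules to kernels of projective presentations preserves
summands, provided that the presentation f of the summand is minimal. The maps
u and v lift to the projective modules; their composite on P is onto because
ker f is superfluous, hence bijective, and it restricts to an injective map of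
the kernel. *)
Lemma uret_syzygy X M P (P' : lmodType A) Y K l m (f : {linear P -> X}) (y : {linear Y -> P})
    (i : {linear K -> P'}) (p : {linear P' -> M}) :
  uniserial P l -> projective P -> uniserial X m -> (0 < m)%N -> range f = setT ->
  injective y -> range y = f @^-1` [set 0] -> projective P' ->
  short_exact i p -> uret X M -> uret Y K.
Proof.
move=> uP pP uX m0 fT yi yk pP' [ii ik pT] [u [v vui]].
have vuT := (uni_inj_surj (v \o u) uX uX).1 vui.
have [a aE] := pP _ _ p (u \o f) pT; have {}aE x : p (a x) = u (f x) := aE x.
have [b bE] := pP' _ _ f (v \o p) fT; have {}bE x : f (b x) = v (p x) := bE x.
have baE x : f (b (a x)) = v (u (f x)) by rewrite bE aE.
have baT : range (b \o a) = setT.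
  have [|//|kT] := uni_sums uP (submodule_range (b \o a)) (submodule_ker f).
    apply/seteqP; split=> // x _; have /rangeTP/(_ (f x))[x' x'E] := vuT.
    have /rangeTP/(_ x')[z zE] := fT; exists (b (a z)); first by exists z.
    by rewrite /= linearB baE zE -x'E subrr.
  by case: (uni_surj_ker uP uX m0 fT).
have bai := (uni_inj_surj (b \o a) uP uP).2 baT.
have fy z : f (y z) = 0.
  by have : range y (y z) by [exists z]; rewrite yk.
have pi z : p (i z) = 0.
  by have : range i (i z) by [exists z]; rewrite ik.
have [|u' u'E] := @lift_inj _ Y P' K i (a \o y) ii.
  by move=> _ [z _ <-]; rewrite ik /= aE fy linear0.
have [|v' v'E] := @lift_inj _ K P Y y (b \o i) yi.
  by move=> _ [z _ <-]; rewrite yk /= bE pi linear0.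
exists u', v' => s t /= /(congr1 y).
by rewrite !v'E /= !u'E /= => /bai/yi.
Qed.

(** Dual of [uret_syzygy]: here minimality says that an endomorphism of J that is
injective on X is injective. *)
Lemma uret_cosyzygy X M J (J' : lmodType A) C K l m (j : {linear X -> J}) (q : {linear J -> C})
    (i : {linear M -> J'}) (p : {linear J' -> K}) :
  uniserial J l -> injective_module J -> uniserial X m -> (0 < m)%N -> injective j ->
  range q = setT -> range j = q @^-1` [set 0] -> injective_module J' ->
  short_exact i p -> uret X M -> uret C K.
Proof.
move=> uJ iJ uX m0 ji qT jk iJ' [ii ik pT] [u [v vui]].
have vuT := (uni_inj_surj (v \o u) uX uX).1 vui.
have [a aE] := iJ' _ _ j (i \o u) ji; have {}aE x : a (j x) = i (u x) := aE x.
have [b bE] := iJ _ _ i (j \o v) ii; have {}bE x : b (i x) = j (v x) := bE x.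
have baE x : b (a (j x)) = j (v (u x)) by rewrite aE bE.
have bai : injective (b \o a).
  have [|j0|k0] := uni_disj uJ (submodule_range j) (submodule_ker (b \o a)).
  - move=> _ [[x _ <-]] /=; rewrite baE => h.
    have -> : x = 0 by apply: vui; apply: ji; rewrite /= h !linear0.
    by rewrite linear0.
  - case: ((uni_gt0 uX).1 m0); apply/seteqP; split=> // x _.
    by apply: ji; rewrite linear0; have : range j (j x) by [exists x]; rewrite j0.
  - exact/inj_ker.
have qj z : q (j z) = 0 by have : range j (j z) by [exists z]; rewrite jk.
have pi z : p (i z) = 0 by have : range i (i z) by [exists z]; rewrite ik.
have [|u' u'E] := @fact_surj _ J K C q (p \o a) qT.
  move=> x qx; have : range j x by rewrite jk.
  by case=> z _ <-; rewrite /= aE pi.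
have [|v' v'E] := @fact_surj _ J' C K p (q \o b) pT.
  move=> x px; have : range i x by rewrite ik.
  by case=> z _ <-; rewrite /= bE qj.
exists u', v'; apply: inj_ker0 => c /=.
have /rangeTP/(_ c)[x <-] := qT; rewrite u'E /= v'E /= => qba.
have : range j (b (a x)) by rewrite jk.
case=> t _ tE; have /rangeTP/(_ t)[z zE] := vuT.
by rewrite (bai x (j z)) ?qj//= baE -tE -zE.
Qed.

End Covers.

(** * Projective covers and injective envelopes over a Nakayama algebra *)
Section Nakayama.
Variable A : pzRingType.
Implicit Types M N K P J X S T Y : lmodType A.

Definition generated_by (ix : finType) (Q : ix -> lmodType A) :=
  forall M (U : set M), submodule U -> U <> setT ->
    exists i (f : {linear Q i -> M}), ~ range f `<=` U.

Variables (ix : finType) (Q : ix -> lmodType A) (len : ix -> nat).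
Hypothesis Qproj : forall i, projective (Q i).
Hypothesis Quni : forall i, uniserial (Q i) (len i).
Hypothesis Qgen : generated_by Q.
Hypothesis indec_uni : forall M, fin_gen M -> indecomposable M -> exists n, uniserial M n.

Lemma surj_of_not_rad M N n (f : {linear M -> N}) : uniserial N n ->
  ~ range f `<=` filt N n.-1 -> range f = setT.
Proof.
move=> uN nf; apply: contrapT => nT; apply: nf.
by apply: (uni_proper uN) => //; exact: submodule_range.
Qed.

Lemma cover_exists M n : uniserial M n -> (0 < n)%N ->
  exists i (f : {linear Q i -> M}), range f = setT.
Proof.
move=> uM n0; have [|i [f nf]] := Qgen (@submodule_filt _ M n.-1).
  move=> fT; have [|_] := @filt_lt _ _ _ uM n.-1 n _ (leqnn n); first by lia.
  by rewrite fT => /(_ (@subsetT _ _)).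
by exists i, f; exact: surj_of_not_rad uM nf.
Qed.

Lemma uni_bounded M n : uniserial M n -> (n <= \max_i len i)%N.
Proof.
move=> uM; case: (posnP n) => [->//|/(cover_exists uM)[i [f fT]]].
by have [le _ _] := uni_ker (Quni i) uM fT; apply: leq_trans le (leq_bigmax _).
Qed.

Lemma generated_above_maximal : above_maximal A.
Proof.
move=> N D sD DT; have [i [f nf]] := Qgen sD DT.
have [k kn kE] := filtE (Quni i) (submodule_preimage f sD).
have {}kn : (k < len i)%N.
  rewrite ltn_neqAle kn andbT; apply/eqP => kl; apply: nf => _ [x _ <-].
  have : (f @^-1` D) x by rewrite kE kl (filtT (Quni i)).
  by [].
have [[lt nlt] mx] := uni_maximal (Quni i) kn.
have sf : submodule (f @` filt (Q i) k.+1) by exact/submodule_image/submodule_filt.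
exists (sums D (f @` filt (Q i) k.+1)); first exact: submodule_sums.
split.
  split; first exact: sumsl.
  move=> le; apply: nlt; rewrite -kE => x fx; apply: le; exact: sumsr.
move=> W sW DW Wle.
have [|||WE|WE] := mx ((f @^-1` W) `&` filt (Q i) k.+1).
- by apply: submoduleI; [exact: submodule_preimage | exact: submodule_filt].
- by move=> x fx; split; [apply: DW; move: fx; rewrite -kE | exact: lt].
- by move=> x [].
- left; apply/seteqP; split=> // x Wx; have [d Dd [y fy yE]] := Wle _ Wx.
  rewrite -[x](subrK d); apply: (subD sD) => //; rewrite -yE.
  suff : (f @^-1` D) y by [].
  rewrite kE -WE; split=> //=; rewrite yE; apply: (subB sW) => //; exact: DW.
- right; apply/seteqP; split=> // x [d Dd [y fy yE]].
  have [Wy _] : ((f @^-1` W) `&` filt (Q i) k.+1) y by rewrite WE.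
  rewrite -[x](subrK d) -yE; apply: (subD sW) => //; exact: DW.
Qed.

(** An extension X of a simple module by J that is indecomposable would be a
longer uniserial module containing J. So X is decomposable; as J is uniserial it
meets one of the two summands in zero, and such a summand V is a complement of J
because the quotient by J is simple. *)
Lemma maximal_uni_split J m X (j : {linear J -> X}) : uniserial J m -> (0 < m)%N ->
  (forall Y n (h : {linear J -> Y}), uniserial Y n -> injective h -> (n <= m)%N) ->
  injective j -> maximal_in (range j) setT -> exists r : {linear X -> J}, cancel j r.
Proof.
move=> uJ m0 maxJ ji [[_ nT] mx].
have sj := submodule_range j.
have split_by V : submodule V -> V <> [set 0] -> j @^-1` V = [set 0] ->
    exists r : {linear X -> J}, cancel j r.
  move=> sV V0 jV.
  have jV0 : range j `&` V `<=` [set 0].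
    move=> _ [[x _ <-] Vx]; have : (j @^-1` V) x by [].
    by rewrite jV => ->; rewrite /= linear0.
  have jVT : sums (range j) V = setT.
    have [||||] := mx (sums (range j) V) => //.
    - exact: submodule_sums.
    - exact: sumsl.
    - move=> E; case: V0; apply: sub_eq0 => // x Vx; apply: jV0; split=> //.
      by rewrite -E; exact: sumsr.
  have [p [pj rp _]] := proj_exists sj sV jV0 jVT.
  have [|r rE] := @lift_inj _ X X J j p ji; first by rewrite rp.
  by exists r => x; apply: ji; rewrite rE pj//; exists x.
have fX : fin_gen X.
  have [x xT] := uni_cyc uJ.
  move: nT => /existsNP[y /not_implyP[_ ny]].
  have yT : sums (range j) (cyc y) = setT.
    have [||||] := mx (sums (range j) (cyc y)) => //.
    - exact: submodule_sums (submodule_cyc _).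
    - exact/sumsl/submodule_cyc.
    - move=> E; case: ny; rewrite -E; apply: sumsr => //; exact: cyc_id.
  exists 2%N, (fun i => if i == ord0 then j x else y) => z.
  have : [set: X] z by []; rewrite -yT => -[_ [u _ <-] [b _ bE]].
  have : [set: J] u by []; rewrite -xT => -[a _ aE].
  exists (fun i => if i == ord0 then a else b).
  by rewrite big_ord_recl big_ord1 /= bE -linearZ aE addrC subrK.
have X0 : [set: X] <> [set 0].
  move=> X0; apply: nT => x; rewrite X0 => ->; exact: sub0.
have [iX|nX] := pselect (indecomposable X).
  have [n uX] := indec_uni fX iX; have nm := maxJ _ _ j uX ji.
  have [mn rj _] := uni_range uX uJ ji.
  by case: nT; rewrite rj -(filtT uX); apply: filt_mono.
have [U [V [sU sV UV _ [U0 V0]]]] := not_indec X0 nX.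
have [|E|E] := uni_disj uJ (submodule_preimage j sU) (submodule_preimage j sV).
- move=> x [Ux Vx]; apply: ji; rewrite linear0.
  by have : (U `&` V) (j x) by []; rewrite UV.
- exact: split_by E.
- exact: split_by E.
Qed.

(** Lengths are bounded, so M embeds in a uniserial module of maximal length, to
which the two preceding criteria apply. *)
Lemma hull_exists M n : uniserial M n -> (0 < n)%N ->
  exists J m (j : {linear M -> J}), [/\ injective_module J, uniserial J m & injective j].
Proof.
move=> uM n0.
pose has_ext m := `[< exists J (j : {linear M -> J}), uniserial J m /\ injective j >].
have ex : exists m, has_ext m.
  by exists n; apply/asboolP; exists M, idfun; split=> // x y.
have ub m : has_ext m -> (m <= \max_i len i)%N.
  by move=> /asboolP[J [j [uJ _]]]; exact: uni_bounded uJ.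
have [m /asboolP[J [j [uJ ji]]] mmax] := ex_maxnP ex ub.
have m0 : (0 < m)%N by have [le _ _] := uni_range uJ uM ji; lia.
exists J, m, j; split=> //.
apply: (maximal_split_injective generated_above_maximal) => X h hi mh.
apply: (maximal_uni_split uJ m0) hi mh => Y n' h' uY h'i.
apply: mmax; apply/asboolP; exists Y, (h' \o j); split=> //.
exact: inj_comp.
Qed.
End Nakayama.

(** * Least elements and finite sets *)
Lemma least_some (F : nat -> Prop) n : F n -> (forall m, (m < n)%N -> ~ F m) ->
  least F = Some n.
Proof.
move=> Fn nF; rewrite /least; case: pselect => [ex|[]]; last by exists n; apply/asboolP.
case: ex_minnP => m /asboolP Fm mmin; congr Some; apply/eqP.
rewrite eqn_leq mmin /=; last exact/asboolP.
by rewrite leqNgt; apply/negP => /nF.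
Qed.

Lemma least_ge (F : nat -> Prop) n : (forall m, (m < n)%N -> ~ F m) ->
  least F = None \/ exists2 m, (n <= m)%N & least F = Some m.
Proof.
move=> nF; rewrite /least; case: pselect => [ex|]; [right|by left].
case: ex_minnP => m /asboolP Fm _; exists m => //.
by rewrite leqNgt; apply/negP => /nF.
Qed.

Lemma min_least (F G : nat -> Prop) n : (forall m, (m < n)%N -> ~ F m) ->
  (forall m, (m < n)%N -> ~ G m) -> F n \/ G n ->
  min_inf (least F) (least G) = Some n.
Proof.
move=> nF nG [Fn|Gn].
  rewrite (least_some Fn nF).
  by have [->|[m nm ->]] := least_ge nG => //=; congr Some; exact/minn_idPl.
rewrite (least_some Gn nG).
by have [->|[m nm ->]] := least_ge nF => //=; congr Some; exact/minn_idPr.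
Qed.

Lemma pigeonhole (I : finType) (f : nat -> I) :
  exists i j, (i < j)%N /\ f i = f j.
Proof.
apply: contrapT => nf.
have fi : injective (fun i : 'I_#|I|.+1 => f i).
  move=> i j fij; apply: val_inj => /=.
  by have [lt|lt|//] := ltngtP i j; case: nf; [exists i, j | exists j, i].
by have := leq_card _ fi; rewrite card_ord ltnn.
Qed.


(** * Combinatorics of a monotone function and its adjoint *)
Section Intervals.
Local Open Scope nat_scope.

(** The sequence u, v, f u, f v, f (f u), ... The interval [u, v[ has as its n-th
syzygy the interval between the terms n and n + 1, for f = p; for the
cosyzygies, f is the adjoint and the endpoints are given in reverse order. *)
Fixpoint zigzag (f : nat -> nat) u v n := if n is n'.+1 then zigzag f v (f u) n' else u.

Lemma zigzag_double f u v k : zigzag f u v k.*2 = iter k f u.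
Proof. by elim: k u v => // k IH u v; rewrite doubleS /= IH -iterSr. Qed.

Lemma zigzag_doubleS f u v k : zigzag f u v k.*2.+1 = iter k f v.
Proof. by rewrite /= zigzag_double. Qed.

Lemma zigzagSS f u v n : zigzag f u v n.+2 = f (zigzag f u v n).
Proof. by elim: n u v => //= n IH u v; rewrite -IH. Qed.

Variable p : nat -> nat.
Hypothesis p_mono : {homo p : x y / x <= y}.
Hypothesis p_ge : forall x, x <= p x.

Lemma ladj_ex j : exists l, j <= p l. Proof. by exists j. Qed.
Definition ladj j := ex_minn (ladj_ex j).

Local Notation q := ladj.

Lemma ladjP j l : (q j <= l) = (j <= p l).
Proof.
rewrite /ladj; case: ex_minnP => m jm mmin; apply/idP/idP; last exact: mmin.
by move=> /p_mono; exact: leq_trans.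
Qed.

Lemma iter_mono k : {homo iter k p : x y / x <= y}.
Proof. by move=> x y xy; elim: k => //= k; exact: p_mono. Qed.

Lemma iter_ladjP k j l : (iter k q j <= l) = (j <= iter k p l).
Proof. by elim: k j l => //= k IH j l; rewrite ladjP IH -iterSr. Qed.

Lemma iter_qp_le j k z : j <= k -> iter j q (iter k p z) <= iter (k - j) p z.
Proof. by move=> jk; rewrite iter_ladjP -iterD subnKC. Qed.

Lemma iter_pq_le j k z : j <= k -> iter j p (iter j q (iter k p z)) <= iter k p z.
Proof.
move=> jk; apply: leq_trans (iter_mono j (iter_qp_le z jk)) _.
by rewrite -iterD subnKC.
Qed.

(** The least n with [stop a n] is e(S) for S = [a, a + 1[ with injective envelope
[0, a + 1[. For even n it says that the resolution of the envelope ends at step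
n, for odd n that the resolution of S does. *)
Definition stop a n :=
  if odd n then iter n./2.+1 p a == iter n./2.+1 p a.+1
  else iter n./2 p a.+1 == iter n./2.+1 p 0.

Section Stop.
Variables (a N : nat).
Let b := a.+1.
Hypothesis b_le : b <= p 0.
Hypothesis stopN : stop a N.
Hypothesis goN : forall n, n < N -> ~~ stop a n.

Lemma go_even k : k.*2 < N -> iter k p b < iter k.+1 p 0.
Proof.
move=> /goN; rewrite /stop odd_double doubleK => ne.
by rewrite ltn_neqAle ne /= -iterS iterSr; exact: iter_mono.
Qed.

Lemma go_odd k : k.*2 <= N -> iter k p a < iter k p b.
Proof.
case: k => [//|k]; rewrite doubleS => /goN.
rewrite /stop /= odd_double uphalf_double => ne.
by rewrite ltn_neqAle ne /=; exact/p_mono/iter_mono.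
Qed.

Lemma go0 k : k.*2 <= N -> iter k p 0 < iter k p b.
Proof. by move=> /go_odd; apply: leq_ltn_trans; exact: iter_mono. Qed.

Lemma half_cases m : exists k, m = k.*2 \/ m = k.*2.+1.
Proof.
by exists m./2; rewrite -{1 3}[m]odd_double_half; case: odd; [right|left].
Qed.

(** Neither the resolution of the envelope nor that of S ends before step N: the
parities at which [stop] does not speak about one of them are covered by the
other, through p 0 <= p a. *)
Lemma zigzag0_lt m : m <= N -> zigzag p 0 b m < zigzag p 0 b m.+1.
Proof.
have [k [->|->]] := half_cases m.
  by rewrite zigzag_doubleS zigzag_double => /go0.
by rewrite -doubleS zigzag_doubleS zigzag_double => /go_even.
Qed.

Lemma zigzaga_lt m : m <= N -> zigzag p a b m < zigzag p a b m.+1.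
Proof.
have [k [->|->]] := half_cases m.
  by rewrite zigzag_doubleS zigzag_double => /go_odd.
rewrite -doubleS zigzag_doubleS zigzag_double => /go_even /leq_trans; apply.
exact: iter_mono.
Qed.

(* The module N S is the interval [s, b[, and c is the top of its N-th syzygy,
   the projective module [c, p c[. *)
Let s := if odd N then a else 0.
Let c := zigzag p s b N.

Lemma zigzag_stop : zigzag p s b N.+1 = zigzag p s b N.+2.
Proof.
move: stopN; rewrite /s /stop; have [k [->|->]] := half_cases N.
  by rewrite odd_double doubleK zigzag_doubleS -doubleS zigzag_double => /eqP.
rewrite -doubleS zigzag_doubleS zigzag_double /= odd_double uphalf_double.
by move=> /eqP.
Qed.

(* Endpoints of the cosyzygies of the simple module [c, c + 1[ and of its cover. *)
Let yT := zigzag q c.+1 c.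
Let yP := zigzag q (p c) c.

Lemma pcE : p c = zigzag p s b N.+1.
Proof. by rewrite zigzag_stop zigzagSS. Qed.

Lemma c_lt : c < p c.
Proof. by rewrite pcE /c /s; case: odd; [exact: zigzaga_lt | exact: zigzag0_lt]. Qed.

(** The adjunction moves each comparison of terms of the sequences yT and yP to
one between iterates of p, where it becomes a strict inequality that holds
before step N. *)
Lemma y_even j : (j.*2 <= N) -> iter j q c < iter j q c.+1 /\ iter j q c < iter j q (p c).
Proof.
move=> jN.
suff H : iter j p (iter j q c) <= c.
  by split; rewrite ltnNge iter_ladjP -ltnNge; [|apply: leq_trans c_lt]; rewrite ltnS.
rewrite /c /s; have [k [E|E]] := half_cases N; rewrite E in jN *.
  by rewrite odd_double zigzag_double; apply: iter_pq_le; lia.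
by rewrite /= odd_double zigzag_double; apply: iter_pq_le; lia.
Qed.

Lemma y_odd j : j.*2 < N ->
  iter j.+1 q c.+1 < iter j q c /\ iter j.+1 q (p c) < iter j q c.
Proof.
move=> jN.
suff H : iter j.+1 q (p c) < iter j q c.
  split=> //; apply: leq_ltn_trans H; rewrite iter_ladjP.
  apply: leq_trans c_lt _; rewrite -iter_ladjP //.
rewrite ltnNge iter_ladjP -ltnNge.
have [k [E|E]] := half_cases N; rewrite E in jN.
  have -> : p c = iter k p b by rewrite pcE E zigzag_doubleS.
  have -> : c = iter k p 0 by rewrite /c /s E odd_double zigzag_double.
  case: k E jN => [|k] E jN; first by lia.
  apply: leq_ltn_trans (@go_even k _); last by lia.
  rewrite /= -iterS; have jk : j < k.+1 by lia.
  have := iter_mono j (iter_qp_le b jk); rewrite -iterD.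
  by have -> : j + (k.+1 - j.+1) = k by lia.
have -> : p c = iter k.+1 p a by rewrite pcE /s E -doubleS zigzag_double /= odd_double.
have -> : c = iter k p b by rewrite /c E zigzag_doubleS.
apply: leq_ltn_trans (@go_odd k _); last by lia.
have jk : j < k.+1 by lia.
have := iter_mono j (iter_qp_le a jk); rewrite -iterD.
by have -> : j + (k.+1 - j.+1) = k by lia.
Qed.

Lemma yT_lt m : m <= N -> yT m.+1 < yT m.
Proof.
rewrite /yT; have [k [->|->]] := half_cases m.
  by rewrite zigzag_doubleS zigzag_double => /y_even[].
by rewrite -doubleS zigzag_doubleS zigzag_double => /y_odd[].
Qed.

Lemma yP_lt m : m <= N -> yP m.+1 < yP m.
Proof.
rewrite /yP; have [k [->|->]] := half_cases m.
  by rewrite zigzag_doubleS zigzag_double => /y_even[].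
by rewrite -doubleS zigzag_doubleS zigzag_double => /y_odd[].
Qed.

Lemma iter_qpb k : k.*2 <= N -> iter k q (iter k p b) = b.
Proof.
move=> kN; apply/eqP; rewrite eqn_leq iter_ladjP leqnn /=.
by rewrite ltnNge iter_ladjP -ltnNge; exact: go_odd.
Qed.

Let y := if odd N then yT else yP.

(** At step N the dual sequence reaches the right end b. By [y_stop] the
corresponding left end is 0, so it has returned to the injective envelope
[0, b[. *)
Lemma yNE : y N = b.
Proof.
rewrite /y /yT /yP; have [k [E|E]] := half_cases N.
  rewrite pcE /c E odd_double zigzag_doubleS zigzag_double iter_qpb ?E//.
by rewrite E /= odd_double /= zigzag_double /c E zigzag_doubleS iter_qpb ?E//; lia.
Qed.

Lemma ladj_b : q b = 0.
Proof. by apply/eqP; rewrite -leqn0 ladjP. Qed.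

Lemma y_stop : y N.+1 = 0 /\ y N.+2 = 0.
Proof.
split; last first.
  move: yNE; rewrite /y; case: odd; rewrite /yT /yP zigzagSS => ->;
    exact: ladj_b.
apply/eqP; rewrite -leqn0 /y /yT /yP; have [k [E|E]] := half_cases N.
  by rewrite E odd_double zigzag_doubleS iter_ladjP /c /s E odd_double zigzag_double.
have -> : odd N by rewrite E /= odd_double.
rewrite E -doubleS zigzag_double iter_ladjP.
rewrite /c E zigzag_doubleS; apply: go_even; lia.
Qed.

Lemma y_ge m : m <= N -> b <= y m.
Proof.
have dy i : i <= N -> y i.+1 < y i by rewrite /y; case: odd => [/yT_lt|/yP_lt].
move=> /subKn <-; elim: (N - m) => [|d IH]; first by rewrite subn0 yNE.
have [dN|Nd] := ltnP d N; last by move: IH; have -> : N - d.+1 = N - d by lia.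
apply: leq_trans IH (ltnW _); have -> : N - d = (N - d.+1).+1 by lia.
by apply: dy; lia.
Qed.

(** The right ends of all intervals before step N are at least b, the region where
cosyzygies are computed by the adjoint. *)
Lemma y_gt m : m < N -> a < yT m /\ a < yP m.
Proof.
move=> mN.
have yE k : yT k.*2.+1 = yP k.*2.+1 by rewrite /yT /yP !zigzag_doubleS.
have [k [mE|mE]] := half_cases m; rewrite mE in mN *; last first.
  by rewrite yE; have := y_ge (ltnW mN); rewrite /y; case: odd; rewrite ?yE.
have h : a < yT k.*2.+1 by have := y_ge mN; rewrite /y; case: odd; rewrite ?yE.
split; first by apply: leq_trans h (ltnW _); apply: yT_lt; exact: ltnW.
by apply: leq_trans h (ltnW _); rewrite yE; apply: yP_lt; exact: ltnW.
Qed.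
End Stop.

Lemma iter_fix M x : (forall y, y < M -> y < p y) -> p M = M -> x <= M ->
  iter M p x = M.
Proof.
move=> lt pM xM.
have le k : iter k p x <= M by elim: k => //= k /p_mono; rewrite pM.
have ge k : minn M k <= iter k p x.
  elim: k => [|k IH]; first by rewrite minn0.
  have [h|h] := ltnP (iter k p x) M; first by have /= := lt _ h; lia.
  have -> : iter k.+1 p x = M; last by rewrite geq_minl.
  by rewrite /= -[RHS]pM; congr p; apply/eqP; rewrite eqn_leq le.
by apply/eqP; rewrite eqn_leq le /=; have := ge M; rewrite minnn.
Qed.

Lemma stop_fix a M : (forall y, y < M -> y < p y) -> p M = M -> a < M ->
  exists n, stop a n.
Proof.
move=> lt pM aM; exists M.*2.+1; rewrite /stop /= odd_double uphalf_double.
by rewrite /= !iter_fix // ltnW.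
Qed.

(** Let b = a + 1. If no n stops, then for every k the value p^k (b + n) lies
strictly between p^(k+1) (n - 1) and p^(k+1) n. So modulo the period n the image
of p^(k+1) is strictly smaller than that of p^k, for every k, which is absurd.
The hypothesis on p (n - 1) is the one that expresses the maximality of the
interval [0, b[. *)
Lemma stop_periodic a n : 0 < n -> (forall x, p (x + n) = p x + n) ->
  a.+1 <= p 0 -> p n.-1 <= a + n -> exists m, stop a m.
Proof.
move=> n0 per b_le pn; apply: contrapT => ns.
have go m : ~~ stop a m by apply/negP => h; apply: ns; exists m.
have lt1 k : iter k p a.+1 < iter k.+1 p 0 by exact: (@go_even a k.*2.+1).
have lt2 k : iter k p a < iter k p a.+1 by exact: (@go_odd a k.*2).
have per' k t x : iter k p (x + t * n) = iter k p x + t * n.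
  have per1 y : p (y + t * n) = p y + t * n.
    by elim: t => [|t IH]; rewrite ?addn0// mulSn addnCA addnC per [n + _]addnC addnA -IH.
  by elim: k => //= k ->.
pose D k : {set 'I_n} := finset (fun r : 'I_n => `[< exists x, iter k p x %% n = r >]).
have sub k : D k.+1 \proper D k.
  apply/properP; split.
    apply/fintype.subsetP => r; rewrite !inE => -[x xr].
    by exists (p x); rewrite -iterSr.
  have rn : iter k p (a.+1 + n) %% n < n by rewrite ltn_pmod.
  exists (Ordinal rn); first by rewrite !inE; exists (a.+1 + n).
  apply/negP; rewrite !inE => -[x /= /eqP xE].
  (* Shifting by multiples of the period turns the congruence into an equality. *)
  have [t [u E]] : exists t u, iter k.+1 p (x + t * n) = iter k p (a.+1 + u.+1 * n).
    have [le|/ltnW le] := leqP (iter k.+1 p x) (iter k p (a.+1 + n)).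
      have := xE; rewrite eq_sym eqn_mod_dvd// => /dvdnP[t tE].
      by exists t, 0; rewrite per' mul1n -tE subnKC.
    have := xE; rewrite eqn_mod_dvd// => /dvdnP[t tE].
    exists 0, t; rewrite mul0n addn0 mulSn addnA per' -tE subnKC //.
  have [le|gt] := leqP (x + t * n) (u * n + n.-1).
    have : iter k.+1 p (x + t * n) <= iter k p (a + u.+1 * n).
      rewrite iterSr; apply: iter_mono; apply: leq_trans (p_mono le) _.
      by have := per' 1 u n.-1; rewrite /= addnC => ->; lia.
    by rewrite E !per' leq_add2r leqNgt lt2.
  have : iter k.+1 p (0 + u.+1 * n) <= iter k.+1 p (x + t * n).
    by apply: iter_mono; rewrite mulSn; lia.
  by rewrite E !per' leq_add2r leqNgt lt1.
have card k : #|D k| + k <= n.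
  elim: k => [|k IH]; first by rewrite addn0 -[X in _ <= X]card_ord max_card.
  by have := proper_card (sub k); lia.
by have := card n.+1; lia.
Qed.
End Intervals.

(** * Radicals and projective covers *)
Definition enough_uni_projectives (A : pzRingType) :=
  forall (M : lmodType A) n, uniserial M n -> (0 < n)%N ->
  exists (P : lmodType A) l (f : {linear P -> M}),
    [/\ projective P, uniserial P l & range f = setT].

Definition enough_uni_injectives (A : pzRingType) :=
  forall (M : lmodType A) n, uniserial M n -> (0 < n)%N ->
  exists (J : lmodType A) m (j : {linear M -> J}),
    [/\ injective_module J, uniserial J m & injective j].

Section Predecessors.
Variable A : pzRingType.
Implicit Types M N K P J X S T Y W V : lmodType A.
Hypothesis enough_inj : enough_uni_injectives A.

Lemma uni_cover_iso P (P' : lmodType A) X l l' m (f : {linear P -> X}) (f' : {linear P' -> X}) :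
  projective P -> projective P' -> uniserial P l -> uniserial P' l' -> uniserial X m -> (0 < m)%N ->
  range f = setT -> range f' = setT -> isomorphic P P'.
Proof.
move=> pP pP' uP uP' uX m0 fT f'T.
have [h [hi hT _]] := cover_unique (uni_proj_cover pP uP uX m0 fT)
  (uni_proj_cover pP' uP' uX m0 f'T).
exact: isoI hi hT.
Qed.

Lemma surj_filt M N n m k (f : {linear M -> N}) : uniserial M n -> uniserial N m ->
  range f = setT -> (k <= m)%N -> f @` filt M (n - m + k) = filt N k.
Proof.
move=> uM uN fT km; have [_ _ fk] := uni_ker uM uN fT.
by rewrite -fk// image_preimageK.
Qed.

Lemma range_comp M N K (f : {linear M -> N}) (g : {linear N -> K}) :
  range (g \o f) = g @` range f.
Proof. by rewrite image_comp. Qed.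

Lemma surj_rad M N n m (f : {linear M -> N}) : uniserial M n -> uniserial N m ->
  range f = setT -> (0 < m)%N -> f @` filt M n.-1 = filt N m.-1.
Proof.
move=> uM uN fT m0; have [mn _ _] := uni_ker uM uN fT.
rewrite -(@surj_filt M N n m m.-1 f)//; last by lia.
by congr (f @` filt M _); lia.
Qed.

(** Both modules embed in the injective envelope of T, as its submodule of length
two. *)
Lemma uni2_iso X (X' : lmodType A) T (t : {linear T -> X}) (t' : {linear T -> X'}) :
  uniserial X 2 -> uniserial X' 2 -> uniserial T 1 -> injective t ->
  injective t' -> isomorphic X X'.
Proof.
move=> uX uX' uT ti t'i.
have [J [m [e [iJ uJ ei]]]] := enough_inj uX isT.
have [e' e'E] := iJ _ _ t' (e \o t) t'i; have {}e'E x : e' (t' x) = e (t x) := e'E x.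
have e'i : injective e'.
  have [|t0|/inj_ker//] := uni_disj uX' (submodule_range t') (submodule_ker e').
    move=> _ [[x _ <-]]; rewrite /= e'E => h.
    have -> : x = 0 by apply: ti; apply: ei; rewrite h !linear0.
    by rewrite linear0.
  case: ((uni_gt0 uT).1 isT); apply/seteqP; split=> // x _.
  by apply: t'i; rewrite linear0; have : range t' (t' x) by [exists x]; rewrite t0.
have [_ re _] := uni_range uJ uX ei; have [_ re' _] := uni_range uJ uX' e'i.
by apply: sub_iso ei e'i _; rewrite re re'.
Qed.

(** The quotients of length two of P and P' have isomorphic socles, both covered
by P'', so they are the same submodule of a uniserial injective module. As P and
P' are their projective covers, they are isomorphic. *)
Lemma cover_of_radical_inj P (P' P'' : lmodType A) l l' l'' (g : {linear P'' -> P})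
    (g' : {linear P'' -> P'}) :
  projective P -> projective P' -> uniserial P l -> uniserial P' l' -> uniserial P'' l'' ->
  (1 < l)%N -> (1 < l')%N ->
  range g = filt P l.-1 -> range g' = filt P' l'.-1 -> isomorphic P P'.
Proof.
move=> pP pP' uP uP' uP'' l2 l2' rg rg'.
have top2 (P1 : lmodType A) l1 (g1 : {linear P'' -> P1}) : uniserial P1 l1 -> (1 < l1)%N ->
    range g1 = filt P1 l1.-1 ->
    exists X (f : {linear P1 -> X}) T (t : {linear T -> X}) (h : {linear P'' -> T}),
    [/\ uniserial X 2, range f = setT, uniserial T 1, injective t & range h = setT].
  move=> u1 l12 rg1.
  have [|X [f [fT _ uX]]] := filt_quo u1 (k := (l1 - 2)%N); first by lia.
  rewrite subKn// in uX.
  have [T [t [ti rt uT]]] := filt_sub uX (isT : (1 <= 2)%N).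
  have rfg : range (f \o g1) = filt X 1 by rewrite range_comp rg1 (surj_rad u1 uX fT isT).
  have [|h hE] := @lift_inj _ P'' X T t (f \o g1) ti; first by rewrite rfg rt.
  exists X, f, T, t, h; split=> //.
  apply/rangeTP => x; have : range t (t x) by [exists x].
  by rewrite rt -rfg => -[y _ yE]; exists y; apply: ti; rewrite hE.
have [X [f [T [t [h [uX fT uT ti hT]]]]]] := top2 _ _ g uP l2 rg.
have [X' [f' [T' [t' [h' [uX' f'T uT' t'i h'T]]]]]] := top2 _ _ g' uP' l2' rg'.
have [_ kh _] := uni_ker uP'' uT hT; have [_ kh' _] := uni_ker uP'' uT' h'T.
have /isoP[s [si _]] : isomorphic T T' by apply: quo_iso hT h'T _; rewrite kh kh'.
have /isoP[r [ri rT]] : isomorphic X' X.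
  apply: iso_sym; apply: (uni2_iso uX uX' uT ti (t' := t' \o s)).
  exact: inj_comp.
apply: (uni_cover_iso (f := f) (f' := r \o f')) pP pP' uP uP' uX isT fT _.
by rewrite range_comp f'T.
Qed.

(** Here W is the radical of W'. The map from P'' to W lifts to the radical of the
projective cover P' of W', and the lift is onto because rad P' is uniserial. *)
Lemma cover_of_radical_lift W (W' P' P'' : lmodType A) m l' l'' (w : {linear W -> W'})
    (f' : {linear P' -> W'}) (h : {linear P'' -> W}) :
  uniserial W m -> (0 < m)%N -> uniserial W' m.+1 -> injective w -> uniserial P' l' ->
  range f' = setT -> projective P'' -> uniserial P'' l'' -> range h = setT ->
  exists g : {linear P'' -> P'}, range g = filt P' l'.-1.
Proof.
move=> uW m0 uW' wi uP' f'T pP'' uP'' hT.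
have [l'm _ _] := uni_ker uP' uW' f'T.
have [_ rw _] := uni_range uW' uW wi.
have [|K [k [ki rk uK]]] := filt_sub uP' (k := l'.-1); first by lia.
have rfk : range (f' \o k) = filt W' m by rewrite range_comp rk (surj_rad uP' uW' f'T isT).
have [|s sE] := @lift_inj _ K W' W w (f' \o k) wi; first by rewrite rfk rw.
have sT : range s = setT.
  apply/rangeTP => x; have : range w (w x) by [exists x].
  by rewrite rw -rfk => -[y _ yE]; exists y; apply: wi; rewrite sE.
have [c cE] := pP'' _ _ s h sT; have {}cE x : s (c x) = h x := cE x.
have cT : range c = setT.
  have [|//|kT] := uni_sums uK (submodule_range c) (submodule_ker s).
    apply/seteqP; split=> // x _; have /rangeTP/(_ (s x))[y yE] := hT.
    by exists (c y); [exists y | rewrite /= linearB cE yE subrr].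
  by case: (uni_surj_ker uK uW m0 sT).
by exists (k \o c); rewrite range_comp cT.
Qed.
End Predecessors.

(** * Modules as intervals *)
Section Coordinates.
Variable A : pzRingType.
Implicit Types M N K J X S T Y W V C E : lmodType A.
Hypothesis enough_proj : enough_uni_projectives A.
Hypothesis enough_inj : enough_uni_injectives A.

Variables (P : nat -> lmodType A) (l : nat -> nat).
Variable g : forall i, {linear P i.+1 -> P i}.
Hypothesis Pproj : forall i, projective (P i).
Arguments Pproj : clear implicits.
Hypothesis Puni : forall i, uniserial (P i) (l i).
Hypothesis g_rad : forall i, range (g i) = filt (P i) (l i).-1.
Hypothesis l_end : forall i, (l i <= 1)%N -> l i.+1 = 0%N.

(** The right end of P i seen as an interval; if P i = 0 this is i itself, and
then all later P j vanish as well. *)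
Definition proj_end i := (i + l i)%N.
Local Notation p := proj_end.

Lemma p_succ i : (p i <= p i.+1)%N.
Proof.
have [|K [k [ki rk uK]]] := filt_sub (Puni i) (k := (l i).-1); first by lia.
have [|h hE] := @lift_inj _ _ _ K k (g i) ki; first by rewrite g_rad rk.
have hT : range h = setT.
  apply/rangeTP => x; have : range k (k x) by [exists x].
  by rewrite rk -g_rad => -[y _ yE]; exists y; apply: ki; rewrite hE.
by have [+ _ _] := uni_ker (Puni i.+1) uK hT; rewrite /proj_end; lia.
Qed.

Lemma p_mono : {homo p : x y / (x <= y)%N}.
Proof.
move=> x y /subnKC <-; elim: (y - x)%N => [|d IH]; first by rewrite addn0.
by rewrite addnS; exact: leq_trans IH (p_succ _).
Qed.

Lemma p_ge x : (x <= p x)%N. Proof. exact: leq_addr. Qed.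

Local Notation q := (ladj p_ge).
Let qP := ladjP p_mono p_ge.

(** The module X is the interval [i, j[. Equal endpoints are allowed, so that the
syzygy of a projective module is an interval too. *)
Definition seg i j X :=
  [/\ (i <= j)%N, uniserial X (j - i) & exists f : {linear P i -> X}, range f = setT].

Lemma seg_uni i j X : seg i j X -> uniserial X (j - i). Proof. by case. Qed.

Lemma seg_iso i j X Y : isomorphic X Y -> seg i j X -> seg i j Y.
Proof.
move=> XY [ij uX [f fT]]; split=> //; first exact: uni_iso XY uX.
by have /isoP[h [_ hT]] := XY; exists (h \o f); rewrite range_comp fT.
Qed.

Lemma seg_le i j X : seg i j X -> (j <= p i)%N.
Proof.
case=> ij uX [f fT]; have [+ _ _] := uni_ker (Puni i) uX fT.
by rewrite /proj_end; lia.
Qed.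

Lemma seg_uniq i j X Y : seg i j X -> seg i j Y -> isomorphic X Y.
Proof.
move=> [_ uX [f fT]] [_ uY [h hT]]; apply: (quo_iso fT hT).
have [_ -> _] := uni_ker (Puni i) uX fT.
by have [_ -> _] := uni_ker (Puni i) uY hT.
Qed.

Lemma seg_P i : seg i (p i) (P i).
Proof.
split; [exact: p_ge | by rewrite /proj_end addKn | exists idfun].
by apply/seteqP; split=> // x _; exists x.
Qed.

Lemma seg_exists i j : (i <= j)%N -> (j <= p i)%N -> exists X, seg i j X.
Proof.
move=> ij jp; have [|X [f [fT _ uX]]] := filt_quo (Puni i) (k := (p i - j)%N).
  by rewrite /proj_end; lia.
exists X; split=> //; last by exists f.
by have <- : (l i - (p i - j) = j - i)%N by rewrite /proj_end in jp *; lia.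
Qed.

Lemma seg_rad i j X K (k : {linear K -> X}) : seg i j X -> (i < j)%N ->
  injective k -> range k = filt X (j - i).-1 -> seg i.+1 j K.
Proof.
move=> [_ uX [f fT]] ij ki rk; split=> //.
  have [|uK _] := uni_sub uX ki _ rk; first by lia.
  by have -> : (j - i.+1 = (j - i).-1)%N by lia.
have ji : (0 < j - i)%N by lia.
have rfg : range (f \o g i) = range k.
  by rewrite range_comp g_rad rk (surj_rad (Puni i) uX fT ji).
have [|h hE] := @lift_inj _ _ _ K k (f \o g i) ki; first by rewrite rfg.
exists h; apply/rangeTP => x; have : range k (k x) by [exists x].
by rewrite -rfg => -[y _ yE]; exists y; apply: ki; rewrite hE.
Qed.

Lemma seg_sub i i' j X K (k : {linear K -> X}) : seg i j X -> (i <= i')%N ->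
  (i' <= j)%N -> injective k -> range k = filt X (j - i') -> seg i' j K.
Proof.
move=> sX /subnKC <-; elim: (i' - i)%N K k => [|d IH] K k.
  rewrite addn0 => _ ki; rewrite (filtT (seg_uni sX)) => kT.
  exact: seg_iso (iso_sym (isoI ki kT)) sX.
rewrite addnS => dj ki rk; have uX := seg_uni sX.
have [|K1 [k1 [k1i rk1 uK1]]] := filt_sub uX (k := (j - (i + d))%N); first by lia.
have sK1 : seg (i + d) j K1 by apply: IH k1i rk1; lia.
have [|h hE] := @lift_inj _ K _ K1 k1 k k1i.
  by rewrite rk rk1; apply: filt_mono; lia.
have hi : injective h by move=> x y xy; apply: ki; rewrite -!hE xy.
have [|uK _] := uni_sub uX ki _ rk; first by lia.
have [_ rh _] := uni_range uK1 uK hi.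
apply: (seg_rad sK1 _ hi); first by lia.
by rewrite rh; congr filt; lia.
Qed.

Lemma seg_kerE i j X (f : {linear P i -> X}) : seg i j X -> range f = setT ->
  f @^-1` [set 0] = filt (P i) (p i - j).
Proof.
move=> sX fT; have [_ -> _] := uni_ker (Puni i) (seg_uni sX) fT.
by have := seg_le sX; case: sX => ij _ _; rewrite /proj_end => ?; congr filt; lia.
Qed.

Lemma seg_res i j X : seg i j X -> (i < j)%N ->
  exists (f : {linear P i -> X}) Y (y : {linear Y -> P i}),
  [/\ projective_cover f, short_exact y f & seg j (p i) Y].
Proof.
move=> sX ij; have [_ uX [f fT]] := sX.
have [|Y [y [yi ry uY]]] := filt_sub (Puni i) (k := (p i - j)%N).
  by rewrite /proj_end; lia.
exists f, Y, y; split.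
- have H0 : (0 < j - i)%N by lia.
  exact: (uni_proj_cover (Pproj i) (Puni i) uX H0 fT).
- by split; rewrite // ry (seg_kerE sX).
- by apply: (seg_sub (seg_P i) (ltnW ij) (seg_le sX) yi).
Qed.

Lemma seg_syzygy i j X Y : seg i j X -> (i < j)%N -> is_syzygy X Y -> seg j (p i) Y.
Proof.
move=> sX ij [P' [p' [i' [cp' [i'i ri' p'T]]]]].
have [f [Y0 [y [cf [yi ry fT] sY0]]]] := seg_res sX ij.
have [h [hi hT hE]] := cover_unique cf cp'.
apply: seg_iso sY0; apply: (sub_iso (f := h \o y) (g := i')) => //.
  exact: inj_comp.
rewrite range_comp ri' ry; apply/seteqP; split=> [_ [x fx <-]|x px].
  by rewrite /= hE.
have /rangeTP/(_ x)[z zE] := hT; exists z => //=.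
by rewrite -hE zE.
Qed.

Lemma Omega_syzygy i j X : seg i j X -> (i < j)%N -> seg j (p i) (Omega X).
Proof.
move=> sX ij; apply: (seg_syzygy sX ij); apply: choose_moduleP.
by have [f [Y [y [cf ex _]]]] := seg_res sX ij; exists Y, (P i), f, y.
Qed.

Lemma seg_PC i j X : seg i j X -> (i < j)%N -> seg i (p i) (PC X).
Proof.
move=> sX ij; have [f [Y [y [cf _ _]]]] := seg_res sX ij.
have [h ch] : is_proj_cover X (PC X).
  by apply: choose_moduleP; exists (P i), f.
have [k [ki kT _]] := cover_unique cf ch.
exact: seg_iso (isoI ki kT) (seg_P i).
Qed.

Lemma seg_top i j X : seg i j X -> (i < j)%N -> seg i i.+1 (top X).
Proof.
move=> [_ uX [f fT]] ij; have E : (j - i = (j - i).-1.+1)%N by lia.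
have uX' := uX; rewrite E in uX'; have rE := radicalE uX'.
have [h [hT hk]] : is_top X (top X).
  apply: choose_moduleP.
  have [|Q [h [hT hk _]]] := filt_quo uX' (k := (j - i).-1); first by lia.
  by exists Q, h; rewrite rE.
rewrite rE in hk; split=> //.
  have [|uT _] := uni_quot uX' hT _ hk; first by lia.
  by move: uT; congr uniserial; lia.
by exists (h \o f); rewrite range_comp fT.
Qed.

Lemma seg_soc i j X : seg i j X -> (i < j)%N -> seg j.-1 j (soc X).
Proof.
move=> sX ij; have uX := seg_uni sX; have E : (j - i = (j - i).-1.+1)%N by lia.
have uX' := uX; rewrite E in uX'; have sE := socleE uX'.
have [h [hi rh]] : is_soc X (soc X).
  apply: choose_moduleP; have [|K [k [ki rk _]]] := filt_sub uX (k := 1%N); first by lia.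
  by exists K, k; rewrite sE.
apply: (seg_sub sX _ _ hi); [lia|lia|].
by rewrite rh sE; congr filt; lia.
Qed.

Lemma seg_proj i j X : seg i j X -> (i < j)%N -> projective X <-> j = p i.
Proof.
move=> sX ij; have [_ uX [f fT]] := sX; split=> [pX|E].
  have fi : injective f by apply: (uni_proj_split pX uX _ (Puni i) fT); lia.
  by move: (uni_uniq (uni_iso (isoI fi fT) (Puni i)) uX); rewrite /proj_end; lia.
have fi : injective f.
  by apply/inj_ker; rewrite (seg_kerE sX fT) E subnn.
have [h [fK hK]] := bij_inv fi fT.
exact: projective_retract hK (Pproj i).
Qed.

(** ** Injective envelopes *)

(* I0 is the injective envelope of the simple module under study. *)
Variables (I0 : lmodType A) (b : nat) (f0 : {linear P 0%N -> I0}).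
Hypothesis I0inj : injective_module I0.
Hypothesis I0uni : uniserial I0 b.
Hypothesis b_gt0 : (0 < b)%N.
Hypothesis f0T : range f0 = setT.

Lemma seg_I0 : seg 0 b I0.
Proof. by split; rewrite ?subn0//; exists f0. Qed.

(** If W were longer than b, it would have a uniserial quotient of length b + 1
with radical isomorphic to I0; but an injective submodule is a direct summand. *)
Lemma no_predecessor W n K (k : {linear K -> W}) (h : {linear P 0%N -> K}) :
  uniserial W n -> injective k -> range k = filt W n.-1 -> range h = setT -> (n <= b)%N.
Proof.
move=> uW ki rk hT; rewrite leqNgt; apply/negP => bn.
have [|V [r [rT kr uV]]] := filt_quo uW (k := (n - b.+1)%N); first by lia.
have {}uV : uniserial V b.+1 by move: uV; congr uniserial; lia.
have [|B [c [ci rc uB]]] := filt_sub uV (k := b); first by lia.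
have rrk : range (r \o k) = filt V b.
  by rewrite range_comp rk (surj_rad uW uV rT isT).
have [|s sE] := @lift_inj _ _ _ B c (r \o k \o h) ci.
  by rewrite range_comp hT rrk rc.
have sT : range s = setT.
  apply/rangeTP => x; have : range c (c x) by [exists x].
  rewrite rc -rrk => -[y _ yE]; have /rangeTP/(_ y)[z zE] := hT.
  by exists z; apply: ci; rewrite sE /= zE.
have sB : seg 0 b B by split; rewrite ?subn0//; exists s.
have /isoP[d [di dT]] := seg_uniq seg_I0 sB.
have cdT := uni_inj_split I0inj I0uni b_gt0 uV (inj_comp ci di).
have [bb _ _] := uni_range uV I0uni (inj_comp ci di).
move: cdT; have [_ -> _] := uni_range uV I0uni (inj_comp ci di).
by have [_] := filt_lt uV (ltnSn b) (leqnn _); rewrite (filtT uV) => nle E; apply: nle; rewrite E.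
Qed.

(** Let W embed in a uniserial injective module J. If W is not all of J, let W' be
the submodule of J that contains W with simple quotient. Its projective cover P'
has radical covered by P (q j), so P' is isomorphic to P (q j - 1) by
[cover_of_radical_inj], and W' is the interval [q j - 1, j[: this contradicts
the minimality of q j. For q j = 0 there is no such predecessor, and
[no_predecessor] applies instead. *)
Lemma seg_injective i j W : seg i j W -> (i < j)%N -> (b <= j)%N -> i = q j ->
  injective_module W.
Proof.
move=> sW ij bj iq; have [_ uW [h hT]] := sW.
have m0 : (0 < j - i)%N by lia.
have [J [n [w [iJ uJ wi]]]] := enough_inj uW m0.
have [mn rw _] := uni_range uJ uW wi.
move: mn; rewrite leq_eqVlt => /predU1P[mn|mn].
  have wT : range w = setT by rewrite rw mn (filtT uJ).
  have [v [wK _]] := bij_inv wi wT.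
  apply: (uret_injective uW _ iJ); exists w, v => x y /=.
  by rewrite !wK.
exfalso.
have [//|W' [w' [w'i rw' uW']]] := filt_sub uJ (k := (j - i).+1).
have [|e eE] := @lift_inj _ W _ W' w' w w'i.
  by rewrite rw rw'; apply: filt_mono.
have ei : injective e by move=> x y xy; apply: wi; rewrite -!eE xy.
have [_ re _] := uni_range uW' uW ei.
have [P' [l' [f' [pP' uP' f'T]]]] := enough_proj uW' isT.
have [g' rg'] := cover_of_radical_lift uW m0 uW' ei uP' f'T (Pproj i) (Puni i) hT.
have [l'm _ _] := uni_ker uP' uW' f'T.
(* The index i is q j; there is a predecessor only if it is positive. *)
case: i => [|i] in iq h hT g' rg' sW uW m0 mn W' w' w'i rw' uW' e eE ei re f' f'T l'm rw ij *.
  by have := no_predecessor uW' ei re hT; lia.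
have l2 : (1 < l i)%N.
  rewrite ltnNge; apply/negP => /l_end l0.
  by have := seg_le sW; rewrite /proj_end l0; lia.
have PP' : isomorphic (P i) P'.
  apply: (cover_of_radical_inj enough_inj (Pproj i) pP' (Puni i) uP' (Puni i.+1)
    l2 _ (g_rad i) rg'); lia.
have ll : l i = l' by exact: uni_uniq (uni_iso PP' (Puni i)) uP'.
by have := qP j i; rewrite -iq ltnn /proj_end => /esym/negbT; lia.
Qed.

Lemma seg_hull i j X : seg i j X -> (i < j)%N -> (b <= j)%N ->
  exists E (e : {linear X -> E}) C (c : {linear E -> C}),
  [/\ injective_envelope e, short_exact e c, seg (q j) j E & seg (q j) i C].
Proof.
move=> sX ij bj; have qi : (q j <= i)%N by rewrite qP; exact: seg_le sX.
have [||E sE] := @seg_exists (q j) j; [lia|by rewrite -qP|].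
have uE := seg_uni sE.
have [|K [k [ki rk uK]]] := filt_sub uE (k := (j - i)%N); first by lia.
have sK := seg_sub sE qi (ltnW ij) ki rk.
have /isoP[h [hi hT]] := seg_uniq sX sK.
have ri : range (k \o h) = filt E (j - i) by rewrite range_comp hT rk.
have iE : injective_module E by apply: (seg_injective sE _ bj); lia.
have [|C [c [cT kc uC]]] := filt_quo uE (k := (j - i)%N); first by lia.
exists E, (k \o h), C, c; split=> //.
- apply: (uni_inj_envelope iE uE (seg_uni sX)); first by lia.
  exact: inj_comp.
- by split; rewrite ?ri//; exact: inj_comp.
- split=> //; first by move: uC; congr uniserial; lia.
  by have [_ _ [f fT]] := sE; exists (c \o f); rewrite range_comp fT.
Qed.

Lemma seg_cosyzygy i j X C : seg i j X -> (i < j)%N -> (b <= j)%N ->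
  is_cosyzygy X C -> seg (q j) i C.
Proof.
move=> sX ij bj [J [j' [p' [ej' [j'i rj' p'T]]]]].
have [E [e [C0 [c [ee [ei re cT] sE sC0]]]]] := seg_hull sX ij bj.
have [h [hi hT hE]] := envelope_unique ee ej'.
apply: seg_iso sC0; apply: (quo_iso (f := c) (g := p' \o h)) => //.
  by rewrite range_comp hT.
rewrite -re; apply/seteqP; split=> [_ [x _ <-]|x /=].
  rewrite /= hE; have : range j' (j' x) by [exists x].
  by rewrite rj'.
move=> px; have : range j' (h x) by rewrite rj'.
by case=> y _; rewrite -hE => /hi <-; exists y.
Qed.

Lemma Sigma_cosyzygy i j X : seg i j X -> (i < j)%N -> (b <= j)%N ->
  seg (q j) i (Sigma X).
Proof.
move=> sX ij bj; apply: (seg_cosyzygy sX ij bj); apply: choose_moduleP.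
by have [E [e [C [c [ee ex _ _]]]]] := seg_hull sX ij bj; exists C, E, e, c.
Qed.

Lemma seg_IE i j X : seg i j X -> (i < j)%N -> (b <= j)%N -> seg (q j) j (IE X).
Proof.
move=> sX ij bj; have [E [e [C [c [ee _ sE _]]]]] := seg_hull sX ij bj.
have [h ch] : is_inj_envelope X (IE X).
  by apply: choose_moduleP; exists E, e.
have [k [ki kT _]] := envelope_unique ee ch.
exact: seg_iso (isoI ki kT) sE.
Qed.

Lemma seg_inj i j X : seg i j X -> (i < j)%N -> (b <= j)%N ->
  injective_module X <-> i = q j.
Proof.
move=> sX ij bj; split=> [iX|]; last exact: seg_injective sX ij bj.
have [E [e [C [c [[_ ei _] _ sE _]]]]] := seg_hull sX ij bj.
have uX := seg_uni sX; have uE := seg_uni sE.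
have m0 : (0 < j - i)%N by lia.
have eT := uni_inj_split iX uX m0 uE ei.
have qi : (q j <= i)%N by rewrite qP; exact: seg_le sX.
by have := uni_uniq (uni_iso (isoI ei eT) uX) uE; lia.
Qed.

(** ** Projective and injective dimensions *)

(** The lower bound concerns any module M that has X as a direct summand, which is
the form that passes through an arbitrary, not necessarily minimal, resolution
of M. *)
Lemma pd_lt n i j X M : seg i j X -> uret X M ->
  (forall m, (m <= n.+1)%N -> (zigzag p i j m < zigzag p i j m.+1)%N) -> ~ pd_le n M.
Proof.
elim: n i j X M => [|n IH] i j X M sX XM lt; have ij : (i < j)%N := lt 0%N isT.
  move=> /(uret_projective (seg_uni sX) XM) /(seg_proj sX ij).1 E.
  by have := lt 1%N isT; rewrite /= -E ltnn.
case=> P' [K [i' [p' [pP' ex]]]].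
have [f [Y [y [_ [yi ry fT] sY]]]] := seg_res sX ij.
apply: (IH j (p i) Y K sY); last by move=> m mn; exact: (lt m.+1).
have m0 : (0 < j - i)%N by lia.
exact: (uret_syzygy (Puni i) (Pproj i) (seg_uni sX) m0 fT yi ry pP' ex XM).
Qed.

Lemma pd_stop n i j X : seg i j X ->
  (forall m, (m <= n)%N -> (zigzag p i j m < zigzag p i j m.+1)%N) ->
  zigzag p i j n.+1 = zigzag p i j n.+2 -> pd_le n X.
Proof.
elim: n i j X => [|n IH] i j X sX lt st; have ij : (i < j)%N := lt 0%N isT.
  exact/(seg_proj sX ij).
have [f [Y [y [_ ex sY]]]] := seg_res sX ij.
exists (P i), Y, y, f; split=> //.
by apply: (IH _ _ _ sY _ st) => m mn; exact: (lt m.+1).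
Qed.

Lemma seg_Omega n i j X : seg i j X ->
  (forall m, (m < n)%N -> (zigzag p i j m < zigzag p i j m.+1)%N) ->
  seg (zigzag p i j n) (zigzag p i j n.+1) (iter n (@Omega A) X).
Proof.
elim: n i j X => [//|n IH] i j X sX lt; rewrite iterSr.
apply: IH; last by move=> m mn; exact: (lt m.+1).
by apply: (Omega_syzygy sX); exact: (lt 0%N).
Qed.

Lemma id_lt n i j X M : seg i j X -> uret X M ->
  (forall m, (m <= n.+1)%N -> (zigzag q j i m.+1 < zigzag q j i m)%N) ->
  (forall m, (m <= n)%N -> (b <= zigzag q j i m)%N) -> ~ id_le n M.
Proof.
elim: n i j X M => [|n IH] i j X M sX XM lt bx;
  have ij : (i < j)%N := lt 0%N isT; have bj : (b <= j)%N := bx 0%N isT.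
  move=> /(uret_injective (seg_uni sX) XM) /(seg_inj sX ij bj).1 E.
  by have := lt 1%N isT; rewrite /= -E ltnn.
case=> I' [K [i' [p' [iI' ex]]]].
have [E [e [C [c [[iE ei _] [_ re cT] sE sC]]]]] := seg_hull sX ij bj.
apply: (IH (q j) i C K sC).
- have m0 : (0 < j - i)%N by lia.
  exact: (uret_cosyzygy (seg_uni sE) iE (seg_uni sX) m0 ei cT re iI' ex XM).
- by move=> m mn; exact: (lt m.+1).
- by move=> m mn; exact: (bx m.+1).
Qed.

Lemma id_stop n i j X : seg i j X ->
  (forall m, (m <= n)%N -> (zigzag q j i m.+1 < zigzag q j i m)%N) ->
  (forall m, (m <= n)%N -> (b <= zigzag q j i m)%N) ->
  zigzag q j i n.+1 = zigzag q j i n.+2 -> id_le n X.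
Proof.
elim: n i j X => [|n IH] i j X sX lt bx st;
  have ij : (i < j)%N := lt 0%N isT; have bj : (b <= j)%N := bx 0%N isT.
  exact/(seg_inj sX ij bj).
have [E [e [C [c [[iE ei _] ex sE sC]]]]] := seg_hull sX ij bj.
exists E, C, e, c; split=> //.
apply: (IH _ _ _ sC _ _ st) => m mn; [exact: (lt m.+1) | exact: (bx m.+1)].
Qed.

Lemma seg_Sigma n i j X : seg i j X ->
  (forall m, (m < n)%N -> (zigzag q j i m.+1 < zigzag q j i m)%N) ->
  (forall m, (m < n)%N -> (b <= zigzag q j i m)%N) ->
  seg (zigzag q j i n.+1) (zigzag q j i n) (iter n (@Sigma A) X).
Proof.
elim: n i j X => [//|n IH] i j X sX lt bx; rewrite iterSr.
apply: IH; [|by move=> m mn; exact: (lt m.+1)|by move=> m mn; exact: (bx m.+1)].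
by apply: (Sigma_cosyzygy sX); [exact: (lt 0%N) | exact: (bx 0%N)].
Qed.


(** ** The correspondence of simple modules *)
Variable a : nat.
Hypothesis ba : b = a.+1.

Lemma b_le_p0 : (a.+1 <= p 0)%N.
Proof. by rewrite -ba; exact: seg_le seg_I0. Qed.

(** The simple module T is the interval [c, c + 1[, where [c, p c[ is the N-th
syzygy of NN S. Everything is stated for all modules isomorphic to S and to T,
because the operators on modules depend on chosen representatives. *)
Lemma matching (N : nat) : stop p a N -> (forall n, (n < N)%N -> ~~ stop p a n) ->
  exists T, uniserial T 1 /\ forall S, seg a b S ->
  [/\ e S = Some N, isomorphic T (top (iter N (@Omega A) (NN S)))
    & forall T', isomorphic T T' ->
      e_star T' = Some N /\ isomorphic S (soc (iter N (@Sigma A) (NN_star T')))].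
Proof.
move=> stN goN; have bp := b_le_p0.
(* F1 to F3 concern the resolutions of S and of its envelope, F4 to F8 those of
   T and of its cover. *)
have F1 := zigzaga_lt p_mono bp goN; have F2 := zigzag0_lt p_mono bp goN.
have F3 := zigzag_stop stN; have cp := c_lt p_mono bp stN goN.
have F4 := yT_lt p_mono p_ge bp stN goN; have F5 := yP_lt p_mono p_ge bp stN goN.
have F6 := y_gt p_mono p_ge bp stN goN; have F7 := yNE p_mono p_ge stN goN.
have F8 := y_stop p_mono p_ge bp stN goN; have qb := ladj_b p_mono p_ge bp.
rewrite -ba in F1 F2 F3 F4 F5 F6 F7 F8 cp qb *.
pose c := zigzag p (if odd N then a else 0%N) b N.
rewrite -/c in F4 F5 F6 F7 F8 cp.
have cE : zigzag p (if odd N then a else 0%N) b N = c := erefl.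
clearbody c.
have [T sT] := seg_exists (leqnSn c) cp.
have ab : (a < b)%N by rewrite ba.
exists T; split; first by have := seg_uni sT; rewrite subSnn.
move=> S sS.
have sI : seg 0 b (IE S) by have := seg_IE sS ab (leqnn b); rewrite qb.
have eS : e S = Some N.
  apply: min_least => [n nN|n nN|].
  - by apply: (pd_lt sS (uret_refl S)) => m mn; apply: F1; lia.
  - by apply: (pd_lt sI (uret_refl _)) => m mn; apply: F2; lia.
  - case: (odd N) F3 => F3; first by left; exact: pd_stop sS F1 F3.
    by right; exact: pd_stop sI F2 F3.
have sN : seg (if odd N then a else 0%N) b (NN S) by rewrite /NN eS; case: odd.
split=> // [|T' TT'].
  apply: seg_uniq sT _.
  have F m : (m <= N)%N -> (zigzag p (if odd N then a else 0%N) b m <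
      zigzag p (if odd N then a else 0%N) b m.+1)%N.
    by case: odd; [exact: F1 | exact: F2].
  have := seg_Omega sN (fun m mN => F m (ltnW mN)).
  by move/seg_top => /(_ (F N (leqnn N))); rewrite cE.
have sT' : seg c c.+1 T' := seg_iso TT' sT.
have sP : seg c (p c) (PC T') := seg_PC sT' (leqnn _).
have eT : e_star T' = Some N.
  apply: min_least => [n nN|n nN|].
  - apply: (id_lt sT' (uret_refl T')) => m mn; first by apply: F4; lia.
    by have [] := F6 m; [lia|].
  - apply: (id_lt sP (uret_refl _)) => m mn; first by apply: F5; lia.
    by have [] := F6 m; [lia|].
  - have G m : (m <= N)%N -> (b <= (if odd N then zigzag q c.+1 c else zigzag q (p c) c) m)%N.
      rewrite leq_eqVlt => /predU1P[->|/F6[]]; first by rewrite F7.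
      by case: odd.
    case: (odd N) G F8 => G [F8 F8']; [left|right].
      by apply: (id_stop sT') => //; rewrite F8 F8'.
    by apply: (id_stop sP) => //; rewrite F8 F8'.
split=> //; apply: (seg_uniq sS).
have sNs : seg c (if odd N then c.+1 else p c) (NN_star T') by rewrite /NN_star eT; case: odd.
have sS0 : seg 0 b (iter N (@Sigma A) (NN_star T')).
  case: (odd N) F7 F8 sNs => <- [<- _] sNs.
    by apply: (seg_Sigma sNs) => m mN; [apply: F4; lia | case: (F6 m mN)].
  by apply: (seg_Sigma sNs) => m mN; [apply: F5; lia | case: (F6 m mN)].
by have := seg_soc sS0 b_gt0; rewrite ba.
Qed.


(** If no P k vanishes, the isomorphism class of P k determines those of both
neighbours: the predecessor by [cover_of_radical_inj], the successor as the
cover of the radical. So one repetition makes the whole sequence periodic. *)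
Lemma P_pred i j : (forall k, (0 < l k)%N) -> isomorphic (P i.+1) (P j.+1) ->
  isomorphic (P i) (P j).
Proof.
move=> lpos /isoP[h [hi hT]].
have l2 k : (1 < l k)%N by rewrite ltnNge; apply/negP => /l_end; have := lpos k.+1; lia.
apply: (cover_of_radical_inj enough_inj (Pproj i) (Pproj j) (Puni i) (Puni j)
  (Puni i.+1) (l2 i) (l2 j) (g_rad i) (g' := g j \o h)).
by rewrite range_comp hT g_rad.
Qed.

Lemma P_succ i j : (forall k, (0 < l k)%N) -> isomorphic (P i) (P j) ->
  isomorphic (P i.+1) (P j.+1).
Proof.
move=> lpos /isoP[h [hi hT]].
have lij : l i = l j by exact: uni_uniq (uni_iso (isoI hi hT) (Puni i)) (Puni j).
have l2 k : (1 < l k)%N by rewrite ltnNge; apply/negP => /l_end; have := lpos k.+1; lia.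
have [|K [k [ki rk uK]]] := filt_sub (Puni j) (k := (l j).-1); first by lia.
have m0 : (0 < (l j).-1)%N by have := l2 j; lia.
have [|u uE] := @lift_inj _ _ _ K k (g j) ki; first by rewrite g_rad rk.
have rhg : range (h \o g i) = range k.
  by rewrite range_comp g_rad rk (surj_rad (Puni i) (Puni j) hT).
have [|v vE] := @lift_inj _ _ _ K k (h \o g i) ki; first by rewrite rhg.
apply: (uni_cover_iso (Pproj i.+1) (Pproj j.+1) (Puni i.+1) (Puni j.+1) uK m0
  (f := v) (f' := u)).
- apply/rangeTP => x; have : range k (k x) by [exists x].
  by rewrite -rhg => -[y _ yE]; exists y; apply: ki; rewrite vE.
- apply/rangeTP => x; have : range k (k x) by [exists x].
  by rewrite rk -g_rad => -[y _ yE]; exists y; apply: ki; rewrite uE.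
Qed.

(** The bound on p (n - 1) required by [stop_periodic] is [no_predecessor] for
P (n - 1), whose radical is covered by P n, that is, by P 0. *)
Lemma P_periodic n : (0 < n)%N -> (forall k, (0 < l k)%N) ->
  isomorphic (P 0%N) (P n) -> exists m, stop p a m.
Proof.
move=> n0 lpos P0n.
have Pn x : isomorphic (P x) (P (x + n)).
  by elim: x => [//|x IH]; rewrite addSn; exact: P_succ.
have ln x : l (x + n)%N = l x.
  exact: uni_uniq (Puni _) (uni_iso (Pn x) (Puni x)).
apply: (stop_periodic p_mono n0 _ b_le_p0).
  by move=> x; rewrite /proj_end ln addnAC.
have /isoP[h [_ hT]] := P0n.
have [|K [k [ki rk uK]]] := filt_sub (Puni n.-1) (k := (l n.-1).-1); first by lia.
have nE : n = n.-1.+1 by lia.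
have [h' h'T] : exists h' : {linear P 0%N -> P n.-1.+1}, range h' = setT.
  by rewrite -nE; exists h.
have [|u uE] := @lift_inj _ _ _ K k (g n.-1) ki; first by rewrite g_rad rk.
have uT : range u = setT.
  apply/rangeTP => x; have : range k (k x) by [exists x].
  by rewrite rk -g_rad => -[y _ yE]; exists y; apply: ki; rewrite uE.
have uhT : range (u \o h') = setT by rewrite range_comp h'T.
have := no_predecessor (Puni n.-1) ki rk uhT.
by rewrite /proj_end ba; lia.
Qed.

Lemma stop_exists (ix : finType) (Q : ix -> lmodType A) :
  (forall X n, projective X -> uniserial X n -> (0 < n)%N -> exists i, isomorphic X (Q i)) ->
  (exists S, seg a b S) -> exists n, stop p a n.
Proof.
move=> fin [S sS]; have [l0|lpos] := pselect (exists i, l i == 0%N).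
  case: (ex_minnP l0) => M /eqP lM Mmin.
  have M_after k : l (M + k)%N = 0%N.
    by elim: k => [|k IH]; rewrite ?addn0// addnS l_end// IH.
  apply: (@stop_fix _ p_mono _ M).
  - move=> y yM; rewrite /proj_end -[X in (X < _)%N]addn0 ltn_add2l lt0n.
    by apply/negP => /Mmin; lia.
  - by rewrite /proj_end lM addn0.
  - rewrite ltnNge; apply/negP => /subnKC aM.
    by have := seg_le sS; rewrite /proj_end -{2}aM M_after ba; lia.
have {}lpos k : (0 < l k)%N.
  by rewrite lt0n; apply/negP => lk; apply: lpos; exists k.
pose f i := projT1 (cid (fin _ _ (Pproj i) (Puni i) (lpos i))).
have fP i : isomorphic (P i) (Q (f i)) by rewrite /f; case: cid.
have [i [j [ij fij]]] := pigeonhole f.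
have Pij : isomorphic (P i) (P j).
  by apply: iso_trans (fP i) _; rewrite fij; exact: iso_sym.
apply: (@P_periodic (j - i)); [by lia|by []|].
elim: i j ij {fij} Pij => [|i IH] j ij Pij; first by rewrite subn0.
case: j ij Pij => [//|j] ij /(P_pred lpos) Pij.
by rewrite subSS; exact: IH.
Qed.
End Coordinates.

Section Chain.
Variable A : pzRingType.
Implicit Types M N K J X S T : lmodType A.
Hypothesis enough_proj : enough_uni_projectives A.

Lemma uni0_projective M : uniserial M 0 -> projective M.
Proof.
move=> uM N K h f _; have [|z zE] := @linear_of _ M N (fun=> 0).
  by move=> c x y; rewrite scaler0 addr0.
exists z => x; rewrite /= zE linear0.
by have -> : x = 0 := uni0 uM erefl x; rewrite linear0.
Qed.

Lemma cover_of_radical_exists X n : uniserial X n ->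
  exists X' n' (h : {linear X' -> X}), [/\ projective X', uniserial X' n',
    range h = filt X n.-1 & (n <= 1)%N -> n' = 0%N].
Proof.
move=> uX; have [|K [k [ki rk uK]]] := filt_sub uX (k := n.-1); first by lia.
have [n1|n1] := leqP n 1.
  have n0 : n.-1 = 0%N by lia.
  rewrite n0 in uK rk *.
  by exists K, 0%N, k; split=> //; exact: uni0_projective.
have [|X' [n' [h [pX' uX' hT]]]] := enough_proj uK; first by lia.
exists X', n', (k \o h); split=> //.
by rewrite range_comp hT.
Qed.

Lemma chain_exists M m : uniserial M m -> (0 < m)%N ->
  exists (P : nat -> lmodType A) (l : nat -> nat)
    (g : forall i, {linear P i.+1 -> P i}) (f0 : {linear P 0%N -> M}),
  [/\ forall i, projective (P i), forall i, uniserial (P i) (l i),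
      forall i, range (g i) = filt (P i) (l i).-1,
      forall i, (l i <= 1)%N -> l i.+1 = 0%N & range f0 = setT].
Proof.
move=> uM m0; have [P0 [l0 [f0 [pP0 uP0 f0T]]]] := enough_proj uM m0.
pose st := {X : lmodType A & {n | projective X /\ uniserial X n}}.
pose md (s : st) := projT1 s; pose ln (s : st) := sval (projT2 s).
have next (s : st) : exists s' : st, (exists h : {linear md s' -> md s},
    range h = filt (md s) (ln s).-1) /\ ((ln s <= 1)%N -> ln s' = 0%N).
  case: s => X [n [pX uX]]; have [X' [n' [h [pX' uX' rh n0]]]] := cover_of_radical_exists uX.
  by exists (existT _ X' (exist _ n' (conj pX' uX'))); split=> //; exists h.
pose nxt s := projT1 (cid (next s)).
have nxtP s : (exists h : {linear md (nxt s) -> md s},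
    range h = filt (md s) (ln s).-1) /\ ((ln s <= 1)%N -> ln (nxt s) = 0%N).
  by rewrite /nxt; case: cid.
pose s0 : st := existT _ P0 (exist _ l0 (conj pP0 uP0)).
pose sq i := iter i nxt s0.
pose gg i := projT1 (cid (nxtP (sq i)).1).
exists (md \o sq), (ln \o sq), gg, f0; split=> //.
- by move=> i; case: (svalP (projT2 (sq i))).
- by move=> i; case: (svalP (projT2 (sq i))).
- by move=> i; rewrite /gg; case: cid.
- by move=> i; case: (nxtP (sq i)).
Qed.
End Chain.

(** * The permutation of the simple modules *)
(** On isomorphism classes: T is h(S), and both e(S) and e*(T) are N. *)
Definition matched (A : pzRingType) (S : lmodType A) (N : nat) (T : lmodType A) :=
  forall S', isomorphic S S' ->
  [/\ e S' = Some N, isomorphic T (top (iter N (@Omega A) (NN S')))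
    & forall T', isomorphic T T' ->
      e_star T' = Some N /\ isomorphic S (soc (iter N (@Sigma A) (NN_star T')))].

Lemma simple_matched (A : pzRingType) (ix : finType) (Q : ix -> lmodType A) :
  enough_uni_projectives A -> enough_uni_injectives A ->
  (forall X n, projective X -> uniserial X n -> (0 < n)%N -> exists i, isomorphic X (Q i)) ->
  forall S : lmodType A, simple_module S ->
  exists N (T : lmodType A), simple_module T /\ matched S N T.
Proof.
move=> enp eni fin S /simple_uni uS.
have [J [b [j [iJ uJ ji]]]] := eni _ _ uS isT.
have [b1 rj _] := uni_range uJ uS ji.
have [P [l [g [f0 [pP uP rg l_end f0T]]]]] := chain_exists enp uJ b1.
have ba : b = b.-1.+1 by lia.
have sJ := seg_I0 uJ f0T.
have sS : seg P b.-1 b S.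
  by apply: (seg_sub uP rg sJ _ _ ji); [lia|lia|rewrite rj; congr filt; lia].
have st : exists n, stop (proj_end l) b.-1 n.
  by apply: (stop_exists eni pP uP rg l_end iJ uJ b1 f0T ba fin); exists S.
case: (ex_minnP st) => N stN minN.
have [n nN|T [uT mT]] := matching enp eni pP uP rg l_end iJ uJ b1 f0T ba stN.
  by apply/negP => /minN; lia.
exists N, T; split; first exact/simple_uni.
move=> S' SS'; have [-> tT sT] := mT S' (seg_iso SS' sS); split=> // T' TT'.
have [-> SS] := sT T' TT'; split=> //.
exact: iso_trans SS' SS.
Qed.

Lemma class_eq (A : pzRingType) (S T : lmodType A) (sS : simple_module S)
  (sT : simple_module T) : class_of sS = class_of sT <-> isomorphic S T.
Proof.
split=> [/(congr1 sval)/= E|ST].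
  by have : iso_class T T := iso_refl T; rewrite -E.
apply: eq_exist; exact: iso_classE.
Qed.

Lemma class_repr (A : pzRingType) (C : simple_class A) :
  exists (S : lmodType A) (sS : simple_module S), C = class_of sS.
Proof. by case: C => F [S sS E]; exists S, sS; subst F. Qed.

(** An injective self-map of a type that embeds in a finite type is onto: some
iterate returns to the starting point. *)
Lemma inj_surj_finite (I : finType) (C : Type) (k : C -> I) (h : C -> C) :
  injective k -> injective h -> forall y, exists x, h x = y.
Proof.
move=> ki hi y; have [i [j [ij /ki]]] := pigeonhole (fun n => k (iter n h y)).
elim: i j ij => [|i IH] [//|j] ij; first by exists (iter j h y).
by rewrite !iterS => /hi; exact: IH.
Qed.

(** A submodule U of M is tested by its preimages under the maps from the regular
module to M. *)
Lemma generated_reached (A : pzRingType) (I : finType) (Q : I -> lmodType A) :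
  (forall U : set A^o, submodule U ->
     (forall i (f : {linear Q i -> A^o}), range f `<=` U) -> setT `<=` U) ->
  generated_by Q.
Proof.
move=> gen M U sU UT; apply: contrapT => nf; apply: UT.
apply/seteqP; split=> // x _.
have [|m mE] := @linear_of _ A^o M (fun c : A => c *: x).
  by move=> c y z; rewrite scalerDl -scalerA.
suff : (m @^-1` U) (1 : A) by rewrite /= mE scale1r.
apply: gen => //; first exact: submodule_preimage.
move=> i f _ [z _ <-] /=; apply: contrapT => nU; apply: nf; exists i, (m \o f).
by move/(_ (m (f z))) => mU; apply: nU; apply: mU; exists z.
Qed.

Theorem corollary4p2 (A : pzRingType) (nakA : nakayama_algebra A) :
  exists h h_star : simple_class A -> simple_class A,
    (forall (S : lmodType A) (sS : simple_module S), exists n : nat,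
       e S = Some n /\
       sval (h (class_of sS)) = iso_class (top (iter n (@Omega A) (NN S)))) /\
    (forall (S : lmodType A) (sS : simple_module S), exists n : nat,
       e_star S = Some n /\
       sval (h_star (class_of sS)) =
         iso_class (soc (iter n (@Sigma A) (NN_star S)))) /\
    cancel h h_star /\ cancel h_star h /\
    (forall (S : lmodType A) (sS : simple_module S) (T : lmodType A),
       sval (h (class_of sS)) T -> e_star T = e S).
Proof.
have [artA ser] := nakA.
have [ix [Q [QP /generated_reached Qgen]]] := reg_reached (artin_dcc artA) ser.
have Qproj i : projective (Q i) by have [] := QP i.
pose len i := projT1 (cid (QP i).2).
have Quni i : uniserial (Q i) (len i) by rewrite /len; case: cid.
have enp : enough_uni_projectives A.
  move=> M n uM n0; have [i [f fT]] := cover_exists Qgen uM n0.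
  by exists (Q i), (len i), f.
have eni : enough_uni_injectives A.
  by move=> M n uM n0; exact: (hull_exists Quni Qgen (indec_uni ser) uM n0).
have fin X n : projective X -> uniserial X n -> (0 < n)%N -> exists i, isomorphic X (Q i).
  move=> pX uX n0; have [i [f fT]] := cover_exists Qgen uX n0.
  exists i; apply: iso_sym; apply: (isoI _ fT).
  exact: (uni_proj_split pX uX n0 (Quni i) fT).
have key C : exists D N S sS T sT,
    [/\ C = @class_of A S sS, D = @class_of A T sT & matched S N T].
  have [S [sS ->]] := class_repr C.
  have [N [T [sT m]]] := simple_matched enp eni fin sS.
  by exists (class_of sT), N, S, sS, T, sT.
pose h C := projT1 (cid (key C)).
have hP C : exists N S sS T sT,
    [/\ C = @class_of A S sS, h C = @class_of A T sT & matched S N T].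
  by rewrite /h; case: cid.
have hS S sS : exists N T sT, h (@class_of A S sS) = @class_of A T sT /\ matched S N T.
  have [N [S' [sS' [T [sT [/class_eq SS' -> m]]]]]] := hP (class_of sS).
  exists N, T, sT; split=> // S'' SS''.
  have [e1 e2 e3] := m S'' (iso_trans (iso_sym SS') SS''); split=> // T' TT'.
  by have [e4 e5] := e3 T' TT'; split=> //; exact: iso_trans SS' e5.
(* The socle of the N-th cosyzygy recovers S from T. *)
have hinj : injective h.
  move=> C C'; have [[S [sS ->]] [S' [sS' ->]]] := (class_repr C, class_repr C').
  have [N [T [sT [-> m]]]] := hS S sS; have [N' [T' [sT' [-> m']]]] := hS S' sS'.
  move/class_eq => TT'; apply/class_eq.
  have [_ _ /(_ _ (iso_refl T))[eT sS1]] := m S (iso_refl S).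
  have [_ _ /(_ _ (iso_sym TT'))[eT' sS2]] := m' S' (iso_refl S').
  move: eT' sS2; rewrite eT => -[<-] sS2.
  exact: iso_trans sS1 (iso_sym sS2).
(* A uniserial module has only one simple quotient, so there are at most as many
   simple classes as modules Q i. *)
have kP C : exists i, forall S sS, C = @class_of A S sS ->
    exists f : {linear Q i -> S}, range f = setT.
  have [S0 [sS0 ->]] := class_repr C.
  have [i [f fT]] := cover_exists Qgen ((simple_uni S0).1 sS0) isT.
  exists i => S sS /class_eq/isoP[d [_ dT]]; exists (d \o f).
  by rewrite range_comp fT.
pose k C := projT1 (cid (kP C)).
have ki : injective k.
  move=> C C'; have [[S [sS ->]] [S' [sS' ->]]] := (class_repr C, class_repr C').
  rewrite /k; case: cid => i /= /(_ _ _ erefl)[f fT].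
  case: cid => i' /= /(_ _ _ erefl)[f' f'T] ii; subst i'.
  apply/class_eq; apply: (quo_iso fT f'T).
  have [_ -> _] := uni_ker (Quni i) ((simple_uni S).1 sS) fT.
  by have [_ -> _] := uni_ker (Quni i) ((simple_uni S').1 sS') f'T.
have hsurj := inj_surj_finite ki hinj.
pose h_star D := projT1 (cid (hsurj D)).
have hK' : cancel h_star h by move=> D; rewrite /h_star; case: cid.
have hK : cancel h h_star by move=> C; apply: hinj; rewrite hK'.
exists h, h_star; split; [|split; [|split; [|split]]] => //.
- move=> S sS; have [N [T [sT [-> m]]]] := hS S sS; exists N.
  by have [-> tT _] := m S (iso_refl S); split=> //; exact: iso_classE.
- move=> T' sT'; have [S [sS hsE]] := class_repr (h_star (class_of sT')).
  have [N [T [sT [hE m]]]] := hS S sS; exists N.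
  have TT' : isomorphic T T' by apply/class_eq; rewrite -hE -hsE hK'.
  have [_ _ /(_ _ TT')[-> sS1]] := m S (iso_refl S).
  by split=> //; rewrite hsE; exact: iso_classE.
- move=> S sS T'; have [N [T [sT [-> m]]]] := hS S sS => TT'.
  by have [-> _ /(_ _ TT')[-> _]] := m S (iso_refl S).
Qed.
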